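(* Let $Q$ be a prime with $Q\equiv 5 \pmod 6$. Then: (1) $\bar p(3Q^3n)\equiv 0 \pmod 3$ for all positive integers $n$ coprime to $Q$. (2) $\bar p(Q^3n)\equiv 0 \pmod 3$ for all positive integers $n$ coprime to $Q$ with $n\equiv -1 \pmod 3$.
   Context: An overpartition of $n$ is a non-increasing sequence of positive integers with sum $n$ in which the first occurrence of each integer may be overlined. $\bar p(n)$ denotes the number of overpartitions of $n$ (with $\bar p(0)=1$); its generating function is $\sum_{n\ge 0}\bar p(n)q^n=\prod_{n\ge 1}\frac{1+q^n}{1-q^n}$. *)

(* Defs.v *)
From mathcomp Require Import all_boot.

Set Implicit Arguments.
Unset Strict Implicit.
Unset Printing Implicit Defensive.

(* The list of pairs (part, overlined?) is an overpartition of [n]: an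
   overlined entry at position [i] must be the first occurrence of its part. *)
Definition is_overpartition (n : nat) (s : seq (nat * bool)) : bool :=
  let parts := unzip1 s in
  [&& sorted geq parts, all (leq 1) parts, sumn parts == n &
      all (fun i => nth false (unzip2 s) i ==>
                      (index (nth 0 parts i) parts == i))
          (iota 0 (size s))].

(* Counting happens in the finite type of lists of length at most [n] with
   parts at most [n]; [is_overpartition_bounded] shows that nothing is lost. *)
Definition pbar (n : nat) : nat :=
  #|[set s : n.-bseq ('I_n.+1 * bool) |
      is_overpartition n [seq (val x.1, x.2) | x <- s]]|.

Lemma is_overpartition_bounded n s :
  is_overpartition n s ->
  exists t : n.-bseq ('I_n.+1 * bool), s = [seq (val x.1, x.2) | x <- t].
Proof.
case/and4P=> _ s_gt0 /eqP sum_s _.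
have size_s : size s <= n.
  rewrite -sum_s; elim: s s_gt0 {sum_s} => //= x s IHs /andP[x_gt0 /IHs le_s].
  by rewrite -add1n leq_add.
have part_s : all (fun x => x.1 <= n) s.
  apply/allP=> x /(map_f fst); rewrite -sum_s -/(unzip1 s).
  elim: (unzip1 s) => //= y l IHl; rewrite inE => /predU1P[<-|/IHl le_x].
    exact: leq_addr.
  exact: leq_trans le_x (leq_addl _ _).
have size_t : size [seq (inord x.1 : 'I_n.+1, x.2) | x <- s] <= n.
  by rewrite size_map.
exists (Bseq size_t); rewrite /= -map_comp map_id_in // => x /(allP part_s) le_x.
by rewrite /= inordK ?ltnS //; case: x le_x.
Qed.

(* Main.v *)
(** Gauss's identity says that the generating function of overpartitions is
    1 / theta with theta = sum_k (-1)^k q^(k^2).  Modulo 3, theta(q)^3 is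
    theta(q^3), and taking 3-sections of P theta^3 = theta^2 expresses
    pbar(3n) and pbar(3n+1) through the coefficients of
    theta(q)^2 theta(q^3), that is (up to sign) through the numbers
    r(N) = #{(x,y,z) : x^2 + y^2 + 3z^2 = N}: pbar(3n) = +-r(n), and
    pbar(m) = +-2 r(3m) when m = 1 mod 3.

    It remains to show that 3 divides r(Q^3 m) for m coprime to Q.  A vector w
    of norm Q^3 m determines a unique isotropic line modulo Q, the one for
    which w lies in Q times the corresponding Q-neighbour of Z^3.  The form
    x^2 + y^2 + 3z^2 being alone in its genus, every neighbour is isometric to
    Z^3 and has r(Q m) vectors of norm Q m.  Double counting pairs of a vector
    w and a nonzero isotropic vector modulo Q gives
    (Q - 1) r(Q^3 m) = I r(Q m), where the number I of nonzero isotropic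
    vectors is divisible by 3, as multiplication by a cube root of unity on
    x^2 + 3z^2 permutes them freely; and Q - 1 = 1 mod 3. *)

Require Import Defs.
From mathcomp Require Import all_boot all_order all_algebra.
From mathcomp Require Import zify ring.
Set Implicit Arguments.
Unset Strict Implicit.
Unset Printing Implicit Defensive.
Import Order.TTheory GRing.Theory Num.Theory.

(** * Enumeration of overpartitions *)

(** A local substitute for the first-occurrence condition: in a sorted list equal parts are
    adjacent, so an overlined entry only has to differ from the entry before it. Transitivity then
    makes sortedness a pairwise condition. *)
Definition overgt (x y : nat * bool) : bool :=
  (y.1 <= x.1) && (y.2 ==> (y.1 != x.1)).

Lemma overgt_trans : transitive overgt.
Proof.
case=> [y b] [x a] [z c] /andP[/= le_yx Hy] /andP[/= le_zy Hz].
rewrite /overgt /= (leq_trans le_zy le_yx) /=.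
by apply/implyP=> c1; move: Hz; rewrite c1 /= => zy; lia.
Qed.

(** Removing the head shifts all indices by one, and the only additional way to fail is an overlined
    repetition of [x]. This matches the recursion of [sorted overgt]. *)
Lemma first_occurrences_cons x (s : seq (nat * bool)) :
  all (fun i => nth false (unzip2 (x :: s)) i ==>
         (index (nth 0 (unzip1 (x :: s)) i) (unzip1 (x :: s)) == i))
      (iota 0 (size (x :: s))) =
  all (fun y => y.2 ==> (y.1 != x.1)) s &&
  all (fun i => nth false (unzip2 s) i ==>
         (index (nth 0 (unzip1 s) i) (unzip1 s) == i)) (iota 0 (size s)).
Proof.
rewrite /= eqxx implybT /= -[1]addn0 iotaDl all_map /=.
have -> : all (fun y => y.2 ==> (y.1 != x.1)) s =
  all (fun i => nth false (unzip2 s) i ==> (nth 0 (unzip1 s) i != x.1))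
      (iota 0 (size s)).
  rewrite -[in LHS](mkseq_nth (0, false) s) /mkseq all_map.
  by apply: eq_in_all => i; rewrite mem_iota /= => lt_i; rewrite !(nth_map (0, false)).
rewrite -all_predI; apply: eq_all => i /=.
rewrite add0n add1n; case: nth => //=; rewrite (eq_sym _ x.1).
by case: (x.1 =P _).
Qed.

Lemma is_overpartitionE n s : is_overpartition n s =
  [&& sorted overgt s, all (fun x => 0 < x.1) s & sumn (unzip1 s) == n].
Proof.
rewrite /is_overpartition; set occ := (X in [&& _, _, _ & X]).
suff E : sorted geq (unzip1 s) && occ = sorted overgt s.
  by rewrite -E all_map -andbA; congr (_ && _); rewrite [RHS]andbC -andbA.
rewrite {}/occ; elim: s => [|x s IHs] //; rewrite first_occurrences_cons.
have geq_trans : transitive geq by move=> a b c /= ab bc; exact: leq_trans bc ab.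
rewrite [unzip1 _]/= /= (path_sortedE geq_trans) (path_sortedE overgt_trans) -IHs.
rewrite all_predI all_map /=.
by do !case: (all _ _); case: sorted.
Qed.

Definition valid n s :=
  [&& sorted overgt s, all (fun x => 0 < x.1) s & sumn (unzip1 s) == n].

Lemma valid_cons n x s : valid n (x :: s) =
  [&& 0 < x.1, x.1 <= n, all (overgt x) s & valid (n - x.1) s].
Proof.
rewrite /valid /= (path_sortedE overgt_trans).
have -> : (x.1 + sumn (unzip1 s) == n) = (x.1 <= n) && (sumn (unzip1 s) == n - x.1).
  by lia.
by case: (all (overgt x) s); case: (all _ s);
  case: (sorted _ s); case: (0 < x.1);
  case: (x.1 <= n); rewrite ?andbF.
Qed.

(** The recursion from [n] to [n - m] is not structural, hence [fuel]. Any number of plain copies of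
    [m] is allowed, which is the factor 1 / (1 - q^m). *)
Fixpoint addpart (C : nat -> seq (seq (nat * bool))) (m fuel n : nat) :=
  C n ++ if fuel is k.+1 then
           if m <= n then map (cons (m, false)) (addpart C m k (n - m)) else [::]
         else [::].

(** The part [m] has either plain copies only, possibly none, or an overlined first copy followed by
    plain ones: the factor (1 + q^m) / (1 - q^m). *)
Fixpoint overpartitions (m n : nat) : seq (seq (nat * bool)) :=
  if m is m'.+1 then
    addpart (overpartitions m') m n n ++
    if m <= n then map (cons (m, true)) (addpart (overpartitions m') m n (n - m))
    else [::]
  else if n == 0 then [:: [::]] else [::].

Lemma addpart_fuel C m k n : 0 < m -> n <= k -> addpart C m k n = addpart C m n n.
Proof.
move=> m_gt0; elim/ltn_ind: n k => n IHn [|k]; first by case: n {IHn}.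
case: n IHn => [|n] IHn le_nk /=; first by rewrite leqNgt m_gt0.
case: ifP => // le_mn; congr (_ ++ map _ _).
by rewrite (IHn _ _ k) ?(IHn _ _ n) //; lia.
Qed.

Lemma cons_in_map (T : eqType) (a x : T) s L :
  (x :: s \in map (cons a) L) = (x == a) && (s \in L).
Proof.
apply/mapP/andP => [[t tL [-> ->]]|[/eqP-> sL]]; first by rewrite eqxx.
by exists s.
Qed.

Lemma nil_in_map (T : eqType) (a : T) L : ([::] \in map (cons a) L) = false.
Proof. by apply/mapP=> [[]]. Qed.

(** The condition [all (overgt (m.+1, false)) s] means that parts are at most [m.+1] and that [m.+1]
    is never overlined. *)
Lemma mem_addpart C m k n s :
    (forall n s, (s \in C n) = valid n s && all (fun y => y.1 <= m) s) ->
  n <= k -> (s \in addpart C m.+1 k n) = valid n s && all (overgt (m.+1, false)) s.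
Proof.
move=> memC; elim: k n s => [|k IHk] n [|x s] le_nk /=; rewrite mem_cat memC /=.
- by rewrite !andbT orbF.
- by move: le_nk; rewrite leqn0 => /eqP->; rewrite !valid_cons; case: x => [[|?] ?].
- by case: ifP; rewrite ?nil_in_map !andbT orbF.
rewrite valid_cons; case: x => [[|a] b] /=; first by case: ifP => //= _; rewrite cons_in_map.
case: (leqP a.+1 n) => le_an //=; last first.
  case: ifP => //= le_mn; rewrite cons_in_map.
  by case: eqP => //= -[? ?]; lia.
have below_trans c : overgt (m.+1, c) (a.+1, b) -> all (overgt (a.+1, b)) s ->
    all (overgt (m.+1, c)) s.
  by move=> Hab; apply: sub_all => y; apply: overgt_trans.
(* A leading part below [m.+1] comes from [C], a larger one is impossible, and [m.+1] itself must be
   plain and leaves the tail to the induction hypothesis. *)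
case: (ltngtP a m) => [lt_am|lt_ma|eq_am].
- have -> : overgt (m.+1, false) (a.+1, b) by rewrite /overgt /=; lia.
  have le_all : all (overgt (a.+1, b)) s -> all (fun y => y.1 <= m) s.
    by apply: sub_all => y /andP[/= ? _]; lia.
  have lt_all : all (overgt (a.+1, b)) s -> all (overgt (m.+1, false)) s.
    by apply: sub_all => y /andP[/= ? _]; rewrite /overgt /=; lia.
  have -> : ((a.+1, b) :: s \in if m < n then
      map (cons (m.+1, false)) (addpart C m.+1 k (n - m.+1)) else [::]) = false.
    case: ifP => // _; rewrite cons_in_map.
    by case: eqP => //= -[? ?]; lia.
  rewrite orbF /=; case: (boolP (all (overgt _) s)) => //= H.
  by rewrite le_all // lt_all // !andbT.
- have -> : overgt (m.+1, false) (a.+1, b) = false by rewrite /overgt /=; lia.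
  rewrite !andbF /=; case: ifP => // _; rewrite cons_in_map.
  by case: eqP => //= -[? ?]; lia.
subst a; rewrite le_an cons_in_map IHk; last by lia.
have -> : all (overgt (m.+1, b)) s = all (overgt (m.+1, false)) s by [].
have -> : overgt (m.+1, false) (m.+1, b) = ~~ b.
  by rewrite /overgt /= leqnn eqxx implybF.
rewrite andbF xpair_eqE eqxx eqbF_neg /=.
by case: b {below_trans} => /=; case: (valid _ s); case: (all (overgt _) s).
Qed.

Lemma mem_overpartitions m n s :
  (s \in overpartitions m n) = valid n s && all (fun y => y.1 <= m) s.
Proof.
elim: m n s => [|m IHm] n s /=.
  case: s => [|[[|a] b] s]; first by case: n.
    by rewrite valid_cons /=; case: ifP.
  by rewrite /= andbF; case: ifP.
rewrite mem_cat (mem_addpart _ IHm) //.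
case: s => [|[a b] s].
  by case: ifP; rewrite ?nil_in_map ?orbF ?andbT.
have [le_mn|lt_nm] := leqP m.+1 n; last first.
  rewrite orbF valid_cons /=; case: (leqP a n) => le_an; rewrite ?andbF //=.
  have -> : overgt (m.+1, false) (a, b) by rewrite /overgt /=; lia.
  have -> : a <= m.+1 by lia.
  case: (boolP (all (overgt (a, b)) s)) => [H|_]; rewrite ?andbF //=.
  congr (_ && _); transitivity true; last symmetry.
    by apply: (sub_all _ H) => y /andP[/= ? _]; rewrite /overgt /=; lia.
  by apply: (sub_all _ H) => y /andP[/= ? _]; lia.
rewrite cons_in_map (mem_addpart _ IHm) ?leq_subr // !valid_cons xpair_eqE /=.
case: (boolP (all (overgt (a, b)) s)) => [H|H]; last first.
  rewrite !andbF /=; apply/negP => /and3P[/andP[/eqP ea _] _ H'].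
  by rewrite ea in H; rewrite H' in H.
case: (ltngtP a m.+1) => [lt_am|lt_ma|eq_am] /=.
- have -> : overgt (m.+1, false) (a, b) by rewrite /overgt /=; lia.
  rewrite orbF /=; congr (_ && _); transitivity true; last symmetry.
    by apply: (sub_all _ H) => y /andP[/= ? _]; rewrite /overgt /=; lia.
  by apply: (sub_all _ H) => y /andP[/= ? _]; lia.
- have -> : overgt (m.+1, false) (a, b) = false by rewrite /overgt /=; lia.
  by rewrite !andbF.
subst a; rewrite le_mn /=.
have -> : all (overgt (m.+1, false)) s by exact: H.
have -> : all (fun y => y.1 <= m.+1) s.
  by apply: (sub_all _ H) => y /andP[].
have -> : overgt (m.+1, false) (m.+1, b) = ~~ b.
  by rewrite /overgt /= leqnn eqxx implybF.
by rewrite !andbT; case: (valid _ s); case: b H.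
Qed.

Lemma uniq_map_cons (T : eqType) (a : T) L : uniq (map (cons a) L) = uniq L.
Proof. by apply: map_inj_uniq => ? ? []. Qed.

Lemma uniq_addpart C m k n :
    (forall n s, (s \in C n) = valid n s && all (fun y => y.1 <= m) s) ->
  (forall n, uniq (C n)) -> n <= k -> uniq (addpart C m.+1 k n).
Proof.
move=> memC uniqC; elim: k n => [|k IHk] n le_nk /=; rewrite cat_uniq uniqC //=.
case: ifP => //= lt_mn; rewrite uniq_map_cons IHk ?andbT; last by lia.
apply/hasPn=> _ /mapP[s _ ->]; rewrite memC /=.
by rewrite ltnn andbF.
Qed.

Lemma uniq_overpartitions m n : uniq (overpartitions m n).
Proof.
elim: m n => [|m IHm] n /=; first by case: eqP.
have uA k : k <= n -> uniq (addpart (overpartitions m) m.+1 n k).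
  by apply: uniq_addpart => // ? ?; exact: mem_overpartitions.
rewrite cat_uniq uA //=; case: ifP => //= lt_mn.
rewrite uniq_map_cons uA ?leq_subr // andbT.
apply/hasPn=> _ /mapP[s _ ->]; rewrite (mem_addpart _ (mem_overpartitions m)) //=.
by rewrite /overgt /= eqxx !andbF.
Qed.

Lemma pbar_size n : pbar n = size (overpartitions n n).
Proof.
rewrite /pbar cardE -(size_map (fun t : n.-bseq ('I_n.+1 * bool) =>
  [seq (val x.1, x.2) | x <- t])).
apply/perm_size/uniq_perm; rewrite ?uniq_overpartitions //.
  rewrite map_inj_in_uniq ?enum_uniq // => t1 t2 _ _ /inj_map H.
  by apply/val_inj/H => -[x b] [y c] /= [/val_inj-> ->].
move=> s; rewrite mem_overpartitions; apply/mapP/andP => [[t]|[vs _]].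
  rewrite mem_enum inE is_overpartitionE => vt ->; split => //.
  by apply/allP=> _ /mapP[[y b] _ ->] /=; rewrite -ltnS.
have [t def_s] : exists t : n.-bseq ('I_n.+1 * bool), s = [seq (val x.1, x.2) | x <- t].
  by apply: is_overpartition_bounded; rewrite is_overpartitionE.
by exists t; rewrite // mem_enum inE is_overpartitionE -def_s.
Qed.

(** Here [c] counts the lists in which [m.+1] is never overlined. The two relations are
    multiplication by 1 + q^(m+1) and division by 1 - q^(m+1). *)
Lemma size_overpartitions_rec m : exists c : nat -> nat, forall n,
  size (overpartitions m.+1 n) = c n + (if m < n then c (n - m.+1) else 0) /\
  c n = size (overpartitions m n) + (if m < n then c (n - m.+1) else 0).
Proof.
exists (fun n => size (addpart (overpartitions m) m.+1 n n)) => n; split.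
  rewrite /= size_cat; case: ifP => // _.
  by rewrite size_map addpart_fuel // leq_subr.
case: n => [|n] //=; first by rewrite cats0 addn0.
rewrite size_cat; case: ifP => // lt_mn.
by rewrite size_map addpart_fuel //; lia.
Qed.

(** * The generating function and Gauss's identity *)

Local Open Scope ring_scope.

Section Theta.
Variable R : comNzRingType.

(** The sum over -K <= k <= K of (-1)^k q^(k^2), with the index shifted by [K]. *)
Definition theta (K : nat) : {poly R} :=
  \sum_(i < K.*2.+1) (-1) ^+ `|i - K|%N * 'X^(`|i - K|%N ^ 2).

Lemma theta_recr K :
  theta K.+1 = theta K + (-1) ^+ K.+1 *+ 2 * 'X^(K.+1 ^ 2).
Proof.
rewrite /theta doubleS big_ord_recr big_ord_recl /=.
rewrite subn0.
have -> : `|(K.*2.+2)%N - K.+1|%N = K.+1 by lia.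
rewrite addrAC addrC; congr (_ + _); last by rewrite mulr2n mulrDl.
apply: eq_bigr => i _; rewrite /bump /=.
by have -> : `|(1 + i)%N - K.+1|%N = `|i - K|%N by lia.
Qed.

Let A s : {poly R} := \prod_(i < s) (1 + 'X^(i.+1)).
Let B s n : {poly R} := \prod_(s <= i < n) (1 - 'X^(i.+1)).

(* Finite form of Gauss's identity, due to Shanks; the induction step telescopes. *)
Lemma theta_prod n : theta n * A n =
  B 0 n + \sum_(s < n) (-1) ^+ s.+1 *+ 2 * 'X^(s.+1 * n.+1) * A s * B s.+1 n.
Proof.
elim: n => [|n IHn].
  by rewrite /theta /A /B !big_ord0 big_ord1 big_geq //= expr0 !mul1r addr0.
set x : {poly R} := 'X^(n.+1).
have An : A n.+1 = A n * (1 + x) by rewrite /A big_ord_recr.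
have Bn : B 0 n.+1 = B 0 n * (1 - x) by rewrite /B big_nat_recr.
rewrite theta_recr An Bn mulrDl mulrA IHn {An Bn}.
rewrite big_ord_recr /=; have -> : B n.+1 n.+1 = 1 by rewrite /B big_geq.
(* Term by term, the sum for [n.+1] is [1 + x] times the sum for [n], up to a difference of
   consecutive values of [U]. *)
pose U s := (-1) ^+ s *+ 2 * x ^+ s.+1 * A s * B s n.
have tele : \sum_(s < n) (U s.+1 - U s) = U n - U 0%N.
  by rewrite -(big_mkord xpredT (fun s => U s.+1 - U s)) telescope_sumr.
have -> : \sum_(i < n) (-1) ^+ i.+1 *+ 2 * 'X^(i.+1 * n.+2) * A i *
     B i.+1 n.+1 =
  (1 + x) * \sum_(s < n) (-1) ^+ s.+1 *+ 2 * 'X^(s.+1 * n.+1) * A s * B s.+1 n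
   - \sum_(s < n) (U s.+1 - U s).
  rewrite mulr_sumr -sumrB; apply: eq_bigr => s _.
  have -> : B s.+1 n.+1 = B s.+1 n * (1 - x) by rewrite /B big_nat_recr.
  rewrite /U.
  have -> : B s n = (1 - 'X^(s.+1)) * B s.+1 n by rewrite /B big_ltn.
  have -> : A s.+1 = A s * (1 + 'X^(s.+1)) by rewrite /A big_ord_recr.
  have -> : 'X^(s.+1 * n.+1) = x ^+ s.+1 by rewrite mulnC exprM.
  have -> : 'X^(s.+1 * n.+2) = x ^+ s.+1 * 'X^(s.+1) :> {poly R}.
    by rewrite /x -exprM -exprD; congr ('X^_); lia.
  rewrite !exprS; ring.
rewrite tele /U.
have -> : B n n = 1 by rewrite /B big_geq.
have -> : A 0 = 1 by rewrite /A big_ord0.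
have -> : 'X^(n.+1 ^ 2) = x ^+ n.+1 by rewrite /x -exprM; congr ('X^_); lia.
have -> : 'X^(n.+1 * n.+2) = x ^+ n.+2 :> {poly R}.
  by rewrite /x -exprM; congr ('X^_); lia.
rewrite expr0 !exprS; ring.
Qed.

End Theta.

(** * Power series as polynomials modulo X^N *)

Section Cong.
Variable F : fieldType.
Implicit Types f g h : {poly F}.

Definition congX N f g := 'X^N %| f - g.

Lemma congXP N f g : reflect (forall i, (i < N)%N -> f`_i = g`_i) (congX N f g).
Proof.
apply: (iffP idP) => [/dvdpP[h def_h] i lt_iN|eq_fg].
  have -> : f = g + h * 'X^N by rewrite -def_h; ring.
  by rewrite coefD coefMXn lt_iN addr0.
rewrite /congX -(poly_take_drop N (f - g)).
have -> : take_poly N (f - g) = 0.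
  apply/polyP=> i; rewrite coef_take_poly coefB coef0.
  by case: ifP => // /eq_fg ->; rewrite subrr.
by rewrite add0r dvdp_mull.
Qed.

Lemma congX_refl N f : congX N f f.
Proof. by rewrite /congX subrr dvdp0. Qed.

Lemma congX_sym N f g : congX N f g -> congX N g f.
Proof. by rewrite /congX -opprB dvdpNr. Qed.

Lemma congX_trans N g f h : congX N f g -> congX N g h -> congX N f h.
Proof. by rewrite /congX => fg gh; have := dvdp_add fg gh; rewrite addrA subrK. Qed.

Lemma congX_add N f g f' g' : congX N f g -> congX N f' g' -> congX N (f + f') (g + g').
Proof. by rewrite /congX => fg fg'; rewrite opprD addrACA dvdp_add. Qed.

Lemma congX_mul N f g f' g' : congX N f g -> congX N f' g' -> congX N (f * f') (g * g').
Proof.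
rewrite /congX => fg fg'.
have -> : f * f' - g * g' = (f - g) * f' + g * (f' - g') by ring.
by rewrite dvdp_add ?(dvdp_mulr _ fg) ?(dvdp_mull _ fg').
Qed.

Lemma congX_exp N f g k : congX N f g -> congX N (f ^+ k) (g ^+ k).
Proof.
by move=> fg; elim: k => [|k IHk]; rewrite ?expr0 ?congX_refl // !exprS congX_mul.
Qed.

(** A polynomial with nonzero constant term is coprime to X^N. *)
Lemma congX_cancel N (u f g : {poly F}) :
  u`_0 != 0 -> congX N (f * u) (g * u) -> congX N f g.
Proof.
rewrite /congX -mulrBl => u0; rewrite Gauss_dvdpl //.
apply: coprimep_expl; rewrite coprimep_sym -[X in coprimep _ X]subr0 -polyC0.
by rewrite coprimep_XsubC /root horner_coef0.
Qed.

End Cong.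

(** * The product formula for overpartitions and its inverse theta *)

Section GeneratingFunction.
Variable F : fieldType.

Let A s : {poly F} := \prod_(i < s) (1 + 'X^(i.+1)).
Let B s : {poly F} := \prod_(i < s) (1 - 'X^(i.+1)).

Lemma poly_shift N m (f : nat -> F) :
  congX N (\poly_(n < N) (if (m < n)%N then f (n - m.+1)%N else 0))
          ('X^(m.+1) * \poly_(n < N) f n).
Proof.
apply/congXP=> i lt_iN; rewrite coef_poly lt_iN coefXnM coef_poly.
by rewrite ltnS; case: leqP => //= _; rewrite (leq_ltn_trans (leq_subr _ _)).
Qed.

Lemma overpartitions_gf N m :
  congX N ((\poly_(n < N) (size (overpartitions m n))%:R) * B m) (A m).
Proof.
elim: m => [|m IHm].
  rewrite /A /B !big_ord0 mulr1; apply/congXP=> i lt_iN.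
  by rewrite coef_poly lt_iN coef1 /=; case: i lt_iN.
rewrite /A /B !big_ord_recr /= -/(A m) -/(B m).
have [c Hc] := size_overpartitions_rec m.
pose C : {poly F} := \poly_(n < N) (c n)%:R.
set P' := \poly_(n < N) _; set P := \poly_(n < N) _ in IHm.
have P'C : congX N P' ((1 + 'X^(m.+1)) * C).
  rewrite mulrDl mul1r; apply: congX_trans (congX_add (congX_refl _ _) (poly_shift _ _ _)).
  apply/congXP=> i lt_iN; rewrite coefD !coef_poly lt_iN (Hc i).1 natrD.
  by case: ifP.
have CP : congX N ((1 - 'X^(m.+1)) * C) P.
  rewrite mulrBl mul1r; apply: (@congX_trans _ _ (P + 'X^(m.+1) * C - 'X^(m.+1) * C)); last first.
    by rewrite addrK congX_refl.
  apply: congX_add (congX_refl _ _).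
  apply: congX_trans (congX_add (congX_refl _ _) (poly_shift _ _ _)).
  apply/congXP=> i lt_iN; rewrite coefD !coef_poly lt_iN {1}(Hc i).2 natrD.
  by case: ifP.
apply: (congX_trans (congX_mul P'C (congX_refl _ _))).
have -> : (1 + 'X^(m.+1)) * C * (B m * (1 - 'X^(m.+1))) =
  ((1 - 'X^(m.+1)) * C) * B m * (1 + 'X^(m.+1)) by ring.
apply: congX_mul (congX_refl _ _).
exact: (congX_trans (congX_mul CP (congX_refl _ _))).
Qed.

Lemma size_overpartitions_stable m n : (n <= m)%N -> size (overpartitions m n) = pbar n.
Proof.
rewrite pbar_size => /subnKC <-; elim: (m - n)%N => [|k IHk]; first by rewrite addn0.
have [c Hc] := size_overpartitions_rec (n + k).
rewrite addnS (Hc n).1 (Hc n).2 IHk.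
by rewrite ltnNge leq_addr !addn0.
Qed.

(** With [P * B K] congruent to [A K] and [theta F K * A K] congruent to [B K], the invertible
    factor [A K * B K] cancels from the product. *)
Lemma pbar_theta N K : (N <= K.+1)%N ->
  congX N ((\poly_(n < N) (pbar n)%:R) * theta F K) 1.
Proof.
move=> le_NK; set P := \poly_(n < N) _.
have PBA : congX N (P * B K) (A K).
  have -> : P = \poly_(n < N) (size (overpartitions K n))%:R.
    by apply: eq_poly => i lt_iN; rewrite size_overpartitions_stable //; lia.
  exact: overpartitions_gf.
(* In [theta_prod] every term of the remaining sum is divisible by X^(K+1). *)
have tAB : congX N (theta F K * A K) (B K).
  rewrite /A theta_prod /congX /B big_mkord addrC addKr.
  elim/big_ind: _ => [|f g|s _]; [exact: dvdp0 | exact: dvdp_add |].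
  do 2!apply: dvdp_mulr; apply/dvdp_mull/dvdp_exp2l.
  by rewrite mulSn; lia.
have prod0 (g : nat -> {poly F}) n : (forall i, (g i)`_0 = 1) -> (\prod_(i < n) g i)`_0 = 1.
  by move=> g0; rewrite -horner_coef0 horner_prod big1 // => i _; rewrite horner_coef0.
have A0 : (A K)`_0 = 1.
  by apply: (prod0 (fun i => 1 + 'X^(i.+1))) => i; rewrite coefD coef1 coefXn addr0.
have B0 : (B K)`_0 = 1.
  by apply: (prod0 (fun i => 1 - 'X^(i.+1))) => i; rewrite coefB coef1 coefXn subr0.
apply: (@congX_cancel _ _ (A K * B K)).
  by rewrite coefM big_ord1 A0 B0 mulr1 oner_neq0.
have -> : P * theta F K * (A K * B K) = P * B K * (theta F K * A K) by ring.
by rewrite mul1r; apply: congX_mul.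
Qed.

End GeneratingFunction.

(** * Sections modulo 3 *)

Section Trisection.
Variable F : fieldType.
Implicit Types f g : {poly F}.

Definition sect r f : {poly F} := \poly_(i < size f) f`_(3 * i + r).

Lemma coef_sect r f i : (sect r f)`_i = f`_(3 * i + r).
Proof.
rewrite coef_poly; case: (ltnP i) => [|le_i]; first by [].
by rewrite nth_default //; apply: leq_trans le_i _; lia.
Qed.

Lemma sectD r f g : sect r (f + g) = sect r f + sect r g.
Proof. by apply/polyP=> i; rewrite coefD !coef_sect coefD. Qed.

Lemma sectZ r c f : sect r (c *: f) = c *: sect r f.
Proof. by apply/polyP=> i; rewrite coefZ !coef_sect coefZ. Qed.

Lemma sect0p r : sect r 0 = 0.
Proof. by apply/polyP=> i; rewrite coef_sect !coef0. Qed.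

Lemma sect_Xn r m : (r < 3)%N ->
  sect r 'X^m = if (m %% 3 == r)%N then 'X^(m %/ 3) else 0.
Proof.
move=> lt_r3; apply/polyP=> i; rewrite coef_sect coefXn (fun_if (fun p : {poly F} => p`_i)).
rewrite coef0 coefXn; case: (m %% 3 =P r)%N => [<-|ne_mr].
  by have -> : (3 * i + m %% 3 == m)%N = (i == m %/ 3)%N by lia.
by case: eqP => // def_m; case: ne_mr; lia.
Qed.

(** Multiplication by X^3 shifts each section by one, so sections are linear over polynomials in
    X^3. *)
Lemma sect_comp r f g : (r < 3)%N -> sect r (f * (g \Po 'X^3)) = sect r f * g.
Proof.
move=> lt_r3; elim/poly_ind: g => [|g c IHg]; first by rewrite comp_poly0 !mulr0 sect0p.
rewrite comp_polyD comp_polyM comp_polyX comp_polyC !mulrDr sectD.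
rewrite (mulrA f _ 'X^3) (mulrA (sect r f)) -IHg.
congr (_ + _); last by rewrite ![_ * c%:P]mulrC !mul_polyC sectZ.
apply/polyP=> i; rewrite coefMX !coef_sect. rewrite coefMXn.
case: i => [|i] /=; first by rewrite muln0 add0n lt_r3.
have -> : (3 * i.+1 + r < 3)%N = false by lia.
by congr _`_ _; lia.
Qed.

Lemma trisection f :
  f = (sect 0 f \Po 'X^3) + 'X * (sect 1 f \Po 'X^3) + 'X^2 * (sect 2 f \Po 'X^3).
Proof.
apply/polyP=> i; rewrite !coefD coefXM coefXnM !coef_comp_poly_Xn // !coef_sect.
case: ifP => H1; case: ifP => H2; case: ifP => H3; try case: ifP => H4;
  try case: ifP => H5;
  rewrite ?addr0 ?add0r.
all: try by [exfalso; lia | congr _`_ _; lia].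
Qed.

(** Squaring f = a(X^3) + X c(X^3) puts a^2, 2ac and c^2 into three different residue classes. *)
Lemma sect_sqr f (a := sect 0 f) (c := sect 1 f) : sect 2 f = 0 ->
  sect 0 (f ^+ 2) = a ^+ 2 /\ sect 1 (f ^+ 2) = a * c *+ 2.
Proof.
move=> f2; rewrite {1 2}(trisection f) f2 comp_poly0 mulr0 addr0 -/a -/c.
set g := _ ^+ 2.
have -> : g = 1 * (a ^+ 2 \Po 'X^3) + 'X^1 * ((a * c *+ 2) \Po 'X^3) + 'X^2 * (c ^+ 2 \Po 'X^3).
  rewrite /g (expr2 a) (expr2 c) mulr2n comp_polyD !comp_polyM expr1; ring.
have s1 r : (r < 3)%N -> sect r 1 = if (0 == r)%N then 1 else 0 :> {poly F}.
  by move=> lt_r; rewrite -(expr0 'X) sect_Xn.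
by rewrite !sectD !sect_comp // !s1 // !sect_Xn //= !mul0r !mul1r !addr0 add0r.
Qed.

End Trisection.

(** * The 3-sections of theta *)

Section ThetaSections.
Variable F : fieldType.

Lemma theta_congX N K d : (N <= K.+1 ^ 2)%N -> congX N (theta F (K + d)) (theta F K).
Proof.
move=> le_N; elim: d => [|d IHd]; first by rewrite addn0 congX_refl.
rewrite addnS theta_recr -[theta F K]addr0; apply: congX_add => //.
rewrite /congX subr0; apply/dvdp_mull/dvdp_exp2l; nia.
Qed.

Lemma theta0 : theta F 0 = 1.
Proof. by rewrite /theta big_ord1 /= mul1r. Qed.

Lemma sect_theta_term r k m : (r < 3)%N ->
  sect r ((-1) ^+ k *+ 2 * 'X^m : {poly F}) =
  if (m %% 3 == r)%N then (-1) ^+ k *+ 2 * 'X^(m %/ 3) else 0.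
Proof.
move=> lt_r; have -> : (-1) ^+ k *+ 2 = ((-1) ^+ k *+ 2)%:P :> {poly F}.
  by rewrite polyCMn rmorphXn rmorphN1.
by rewrite !mul_polyC sectZ sect_Xn //; case: ifP; rewrite ?scaler0.
Qed.

(** The surviving terms are those with k = 3j: the exponent 9j^2 becomes 3j^2, and (-1)^(3j) =
    (-1)^j. *)
Lemma sect_theta0 L : sect 0 (theta F (3 * L)) = theta F L \Po 'X^3.
Proof.
elim: L => [|L IHL].
  by rewrite muln0 theta0 comp_polyC -(expr0 'X) sect_Xn.
rewrite (_ : 3 * L.+1 = (3 * L).+3)%N; last by lia.
rewrite !theta_recr !sectD IHL !sect_theta_term //.
have -> : (((3 * L).+1 ^ 2) %% 3 == 0)%N = false.
  by rewrite -modnXm -addn1 mulnC modnMDl.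
have -> : (((3 * L).+2 ^ 2) %% 3 == 0)%N = false.
  by rewrite -modnXm -addn2 mulnC modnMDl.
have -> : (((3 * L).+3 ^ 2) %% 3 == 0)%N by rewrite -modnXm -addn3 mulnC modnMDl.
rewrite !addr0 comp_polyD; congr (_ + _).
have -> : (-1) ^+ (3 * L).+3 = (-1) ^+ L.+1 :> {poly F}.
  by rewrite -signr_odd -[RHS]signr_odd; congr (_ ^+ nat_of_bool _); lia.
have -> : (-1) ^+ L.+1 *+ 2 = ((-1) ^+ L.+1 *+ 2)%:P :> {poly F}.
  by rewrite polyCMn rmorphXn rmorphN1.
rewrite !mul_polyC comp_polyZ comp_Xn_poly -exprM; congr (_ *: 'X^_).
have -> : ((3 * L).+3 ^ 2 = 3 * L.+1 ^ 2 * 3)%N by lia.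
by rewrite mulnK.
Qed.

(** No square is 2 modulo 3. *)
Lemma sect_theta2 K : sect 2 (theta F K) = 0.
Proof.
elim: K => [|K IHK]; first by rewrite theta0 -(expr0 'X) sect_Xn.
rewrite theta_recr sectD IHK sect_theta_term // add0r.
suff -> : (K.+1 ^ 2 %% 3 == 2)%N = false by [].
by rewrite -modnXm; have := ltn_pmod K.+1 (isT : 0 < 3)%N; case: (_ %% _)%N => [|[|[]]].
Qed.

End ThetaSections.

(** * Overpartition numbers modulo 3 as coefficients of theta^5 *)

Section Frobenius.

Lemma F3_eq0 : 3%:R = 0 :> 'F_3.
Proof. by apply/val_inj. Qed.

Lemma F3_cube (f : {poly 'F_3}) : f ^+ 3 = f \Po 'X^3.
Proof.
have p3 : 3%:R = 0 :> {poly 'F_3} by rewrite -polyC_natr F3_eq0.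
elim/poly_ind: f => [|f c IHf]; first by rewrite comp_poly0 expr0n.
rewrite comp_polyD comp_polyM comp_polyX comp_polyC -IHf.
have -> : c%:P = c%:P ^+ 3 :> {poly 'F_3}.
  by rewrite -rmorphXn; congr _%:P; apply/val_inj; case: c => [[|[|[]]]].
set u := c%:P.
have -> : (f * 'X + u ^+ 3) ^+ 3 = f ^+ 3 * 'X^3 + u ^+ 9 + 
    3%:R * (f * 'X * u ^+ 3 * (f * 'X + u ^+ 3)).
  ring.
rewrite p3 mul0r addr0; congr (_ + _).
by rewrite /u -!rmorphXn; congr _%:P; apply/val_inj; case: c {u} => [[|[|[]]]].
Qed.

(** From P t = 1 follows P t(X^3) = t^2 modulo 3. Its sections are (sect 0 P) t = a^2 and (sect 1 P)
    t = 2ac; since a = t^3 up to truncation, they give t^5 and 2 t^2 c. The bound on [L] makes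
    truncation harmless. *)
Lemma pbar_theta5 n L (t := theta 'F_3 (3 * L)) : (9 * n + 9 <= L)%N ->
  (pbar (3 * n))%:R = (t ^+ 5)`_n /\
  (pbar (3 * n + 1))%:R = (t ^+ 5)`_(3 * (3 * n + 1)) *+ 2.
Proof.
move=> le_L.
set N := (3 * n + 3)%N.
have tt : congX N (theta 'F_3 L) t.
  rewrite /t (_ : 3 * L = L + 2 * L)%N; last by lia.
  by apply/congX_sym/theta_congX; nia.
set P : {poly 'F_3} := \poly_(i < 3 * N) (pbar i)%:R.
have Pt : congX (3 * N) (P * t) 1 by apply: pbar_theta; lia.
have Pt3 : congX (3 * N) (P * (t \Po 'X^3)) (t ^+ 2).
  rewrite -F3_cube exprS mulrA -[X in congX _ _ X]mul1r.
  by apply: congX_mul (congX_refl _ _).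
have sect_cong r (f g : {poly 'F_3}) :
    (r < 3)%N -> congX (3 * N) f g -> congX N (sect r f) (sect r g).
  move=> lt_r3 /congXP fg; apply/congXP=> i lt_iN; rewrite !coef_sect fg //; lia.
pose a := sect 0 t; pose c := sect 1 t.
have [sq0 sq1] : sect 0 (t ^+ 2) = a ^+ 2 /\ sect 1 (t ^+ 2) = a * c *+ 2.
  exact/sect_sqr/sect_theta2.
have a3 : congX N a (t ^+ 3).
  by rewrite /a /t sect_theta0 -F3_cube; apply: congX_exp.
have t0 : t`_0 != 0.
  have /congXP/(_ 0%N isT) := @theta_congX 'F_3 1 0 (3 * L) isT.
  by rewrite add0n -/t => ->; rewrite theta0 coef1 oner_neq0.
have E0 : congX N (sect 0 P) (t ^+ 5).
  apply: (congX_cancel t0); rewrite -sect_comp // -exprSr.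
  apply: congX_trans (sect_cong 0%N _ _ isT Pt3) _; rewrite sq0 (exprM t 3 2).
  exact: congX_exp.
have E1 : congX N (sect 1 P) (t ^+ 2 * c *+ 2).
  apply: (congX_cancel t0); rewrite -sect_comp //.
  apply: congX_trans (sect_cong 1%N _ _ isT Pt3) _; rewrite sq1.
  have a2c : congX N (a * c) (t ^+ 2 * c * t).
    by rewrite mulrAC -exprSr; apply: congX_mul a3 (congX_refl _ _).
  by rewrite mulrnAl !mulr2n; apply: congX_add.
split.
  move/congXP: E0 => /(_ n) <-; last by lia.
  by rewrite coef_sect addn0 coef_poly; case: ltnP => //; lia.
have -> : (pbar (3 * n + 1))%:R = (t ^+ 2 * c *+ 2)`_n.
  move/congXP: E1 => /(_ n) <-; last by lia.
  by rewrite coef_sect coef_poly; case: ltnP => //; lia.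
rewrite coefMn; congr (_ *+ 2).
(* Both sides of the goal are coefficients of t^7: t^2 c is its section 1, and the section 0 of t^5
   = t^2 t(X^3) is a^2 t, congruent to t^7. *)
have <- : sect 1 (t ^+ 6 * t) = t ^+ 2 * c.
  by rewrite (exprM t 2 3) F3_cube mulrC sect_comp // mulrC.
have -> : t ^+ 5 = t ^+ 2 * (t \Po 'X^3) by rewrite -F3_cube -exprD.
have -> : (t ^+ 2 * (t \Po 'X^3))`_(3 * (3 * n + 1)) = (a ^+ 2 * t)`_(3 * n + 1).
  by rewrite -sq0 -sect_comp // coef_sect addn0.
rewrite coef_sect.
have /congXP -> // : congX N (a ^+ 2 * t) (t ^+ 6 * t); last by lia.
by apply: congX_mul (congX_refl _ _); rewrite (exprM t 3 2); apply: congX_exp.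
Qed.

End Frobenius.

(** * Reduction of ternary forms of determinant 3 *)

Lemma nearest_multiple (a b : int) : 0 < a ->
  exists k, (2 * (b + k * a) <= a) && (- a <= 2 * (b + k * a)).
Proof.
(* The quotient is b / a rounded to a nearest integer. *)
move=> a_gt0; exists (- ((2 * b + a) %/ (2 * a))%Z).
have := divz_eq (2 * b + a) (2 * a).
have := ltz_pmod (2 * b + a) (_ : 0 < 2 * a).
have := modz_ge0 (2 * b + a) (_ : 2 * a != 0).
move: (_ %/ _)%Z (_ %% _)%Z => k r /(_ ltac:(lia)) r0 /(_ ltac:(lia)) r1 E.
apply/andP; split; nia.
Qed.

(** Lagrange reduction: [b] is reduced modulo [a], and if the last coefficient is then below [a] the
    two are exchanged, which lowers [a]. *)
Lemma binary_reduction (a b c : int) : 0 < a -> 0 < a * c - b ^+ 2 ->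
  exists x y z w : int,
    let a' := a * x ^+ 2 + 2 * b * x * y + c * y ^+ 2 in
    let b' := a * x * z + b * (x * w + y * z) + c * y * w in
    let c' := a * z ^+ 2 + 2 * b * z * w + c * w ^+ 2 in
    [/\ x * w - y * z = 1, 0 < a', 2 * b' <= a', - a' <= 2 * b' & a' <= c'].
Proof.
move=> a_gt0; have [n] := ubnP `|a|%N; elim: n a b c a_gt0 => // n IHn a b c a_gt0 le_an disc.
have [k /andP[k1 k2]] := nearest_multiple b a_gt0.
set b1 := b + k * a in k1 k2; pose c1 := a * k ^+ 2 + 2 * b * k + c.
have disc1 : a * c1 - b1 ^+ 2 = a * c - b ^+ 2 by rewrite /c1 /b1; ring.
have [le_ac|lt_ca] := leP a c1.
  exists 1, 0, k, 1 => /=.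
  rewrite (_ : a * _ + _ + _ = a); last by ring.
  rewrite (_ : a * 1 * k + _ + _ = b1); last by rewrite /b1; ring.
  rewrite (_ : _ + c * 1 ^+ 2 = c1); last by rewrite /c1; ring.
  by split=> //; ring.
have c1_gt0 : 0 < c1.
  have : 0 < a * c1 by have := sqr_ge0 b1; lia.
  by rewrite pmulr_rgt0.
(* The sign of [b1] changes because the exchange is a rotation, of determinant 1. *)
have [|||x [y [z [w]]]] := IHn c1 (- b1) a => //; first by lia.
  by move: disc; rewrite -disc1 sqrrN mulrC.
move=> /= [det a'_gt0 H1 H2 H3].
exists (x * k - y), x, (z * k - w), z => /=.
move: a'_gt0 H1 H2 H3.
rewrite (_ : c1 * _ + _ + a * y ^+ 2 =
  a * (x * k - y) ^+ 2 + 2 * b * (x * k - y) * x + c * x ^+ 2); last by rewrite /c1 /b1; ring.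
rewrite (_ : c1 * x * z + _ + _ =
  a * (x * k - y) * (z * k - w) + b * ((x * k - y) * z + x * (z * k - w)) + c * x * z);
  last by rewrite /c1 /b1; ring.
rewrite (_ : c1 * z ^+ 2 + _ + _ =
  a * (z * k - w) ^+ 2 + 2 * b * (z * k - w) * z + c * z ^+ 2); last by rewrite /c1 /b1; ring.
by split=> //; rewrite -det; ring.
Qed.

Lemma sqr_le_quarter (x y : int) : 2 * x <= y -> - y <= 2 * x -> 4 * x ^+ 2 <= y ^+ 2.
Proof.
move=> H1 H2; have : 0 <= (y - 2 * x) * (y + 2 * x) by apply: mulr_ge0; lia.
by rewrite (_ : _ * _ = y ^+ 2 - 4 * x ^+ 2); [lia | ring].
Qed.

(** The reduction inequalities give 3a^2 <= 4A and A^2 <= 4a, whence 9a^3 <= 64. *)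
Lemma unit_minimum (a b d A C D : int) : 0 < a -> a <= b -> a * b - d ^+ 2 = A ->
    2 * d <= a -> - a <= 2 * d ->
    0 < A -> A * C - D ^+ 2 = 3 * a -> 2 * D <= A -> - A <= 2 * D -> A <= C ->
  a = 1.
Proof.
move=> a_gt0 le_ab Aab d1 d2 A_gt0 AC D1 D2 le_AC.
have d4 := sqr_le_quarter d1 d2; have D4 := sqr_le_quarter D1 D2.
have a2 : a ^+ 2 <= a * b by rewrite expr2 ler_pM2l.
have A2 : A ^+ 2 <= A * C by rewrite expr2 ler_pM2l.
have hA : A ^+ 2 <= 4 * a by lia.
have ha : 3 * a ^+ 2 <= 4 * A by lia.
have ha4 : (3 * a ^+ 2) ^+ 2 <= (4 * A) ^+ 2.
  by rewrite ler_sqr ?nnegrE //; have := sqr_ge0 a; lia.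
have : 9 * a ^+ 3 <= 64.
  rewrite -(ler_pM2l a_gt0).
  have -> : a * (9 * a ^+ 3) = (3 * a ^+ 2) ^+ 2 by ring.
  by apply: le_trans ha4 _; rewrite exprMn; lia.
move=> a3; suff : ~~ (2 <= a) by lia.
apply/negP=> a_ge2; have : 2 ^+ 3 <= a ^+ 3 by rewrite lerXn2r ?nnegrE //; lia.
lia.
Qed.

(** Reducedness forces 3A^2 <= 4 * 3, so A <= 2. *)
Lemma binary_disc3 (A C D : int) :
    0 < A -> A * C - D ^+ 2 = 3 -> 2 * D <= A -> - A <= 2 * D -> A <= C ->
  A = 2 \/ [/\ A = 1, D = 0 & C = 3].
Proof.
move=> A_gt0 AC D1 D2 le_AC; have D4 := sqr_le_quarter D1 D2.
have A2 : A ^+ 2 <= A * C by rewrite expr2 ler_pM2l.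
have A_le2 : ~~ (3 <= A).
  apply/negP=> A_ge3; have : 3 ^+ 2 <= A ^+ 2 by rewrite lerXn2r ?nnegrE //; lia.
  lia.
have [A1|ne_A1] := eqVneq A 1; last by left; lia.
right; move: AC; rewrite A1 in D1 D2 *; have -> : D = 0 by lia.
by rewrite expr0n subr0 mul1r.
Qed.

Section Ternary.
Variables (V : zmodType) (B : V -> V -> int).
Hypothesis Bsym : forall u v, B u v = B v u.
Hypothesis BD : forall u v w, B (u + v) w = B u w + B v w.
Hypothesis BZ : forall u k w, B (u *~ k) w = k * B u w.

Let BDr u v w : B w (u + v) = B w u + B w v.
Proof. by rewrite Bsym BD !(Bsym w). Qed.
Let BZr u k w : B w (u *~ k) = k * B w u.
Proof. by rewrite Bsym BZ (Bsym w). Qed.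

Definition gram u v w := B u u * B v v * B w w + 2 * B u v * B u w * B v w
  - B u u * B v w ^+ 2 - B v v * B u w ^+ 2 - B w w * B u v ^+ 2.

(* Hermite: [u] is shortened until it is no longer than the second vector of a
   basis whose projection orthogonal to [u] is reduced; then [9 a^3 <= 64] for
   [a = B u u]. *)
Lemma ternary_reduction u v w :
    0 < B u u -> 0 < B u u * B v v - B u v ^+ 2 -> gram u v w = 3 ->
  exists e1 e2 e3, [/\ B e1 e1 = 1, B e1 e2 = 0 &
    B e2 e2 = 2 \/ [/\ B e2 e2 = 1, B e3 e3 = 3, B e1 e3 = 0 & B e2 e3 = 0]].
Proof.
have [n] := ubnP `|B u u|%N; elim: n u v w => // n IHn u v w le_n u_gt0 uv_gt0 det3.
(* These entries are [B u u] times the Gram matrix of the projections of [v] and [w] orthogonal to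
   [u]. *)
have [] := @binary_reduction (B u u * B v v - B u v ^+ 2)
  (B u u * B v w - B u v * B u w) (B u u * B w w - B u w ^+ 2) uv_gt0.
  rewrite (_ : _ - _ = B u u * gram u v w); last by rewrite /gram; ring.
  by rewrite det3 mulr_gt0.
move=> x [y [z [t /=]]]; set A := _ * x ^+ 2 + _ + _; set C := _ * z ^+ 2 + _ + _.
set D := _ * x * z + _ + _; move=> [xyzt A_gt0 D1 D2 AC].
pose v1 := v *~ x + w *~ y; pose w1 := v *~ z + w *~ t.
(* Adding a multiple of [u] to [v1] leaves its projection unchanged. *)
have [k /andP[k1 k2]] := nearest_multiple (B u v1) u_gt0.
pose v2 := v1 + u *~ k.
have Buv2 : B u v2 = B u v1 + k * B u u by rewrite /v2 BDr BZr.
have A2 : B u u * B v2 v2 - B u v2 ^+ 2 = A.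
  by rewrite Buv2 /v2 /v1 /A !(BD, BDr, BZ, BZr) (Bsym w v) !(Bsym _ u); ring.
have det2 : gram u v2 w1 = 3.
  transitivity (gram u v w * (x * t - y * z) ^+ 2); last by rewrite det3 xyzt.
  by rewrite /gram /v2 /v1 /w1 !(BD, BDr, BZ, BZr) (Bsym w v) (Bsym v u) (Bsym w u); ring.
have ACD : A * C - D ^+ 2 = 3 * B u u.
  transitivity (gram u v w * (x * t - y * z) ^+ 2 * B u u); last by rewrite det3 xyzt.
  rewrite /A /C /D /gram; ring.
clearbody A C D v2 w1.
have v2_gt0 : 0 < B v2 v2.
  have : 0 < B u u * B v2 v2 by have := sqr_ge0 (B u v2); lia.
  by rewrite pmulr_rgt0.
have [lt_vu|le_uv] := ltP (B v2 v2) (B u u).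
  apply: (IHn v2 u w1); [lia | by [] | by rewrite Bsym mulrC A2 |].
  by rewrite -det2 /gram (Bsym v2 u); ring.
have u1 : B u u = 1.
  by apply: (@unit_minimum _ (B v2 v2) (B u v2) A C D); rewrite // ?Buv2.
have uv2 : B u v2 = 0 by lia.
(* As [B u u = 1], orthogonal projection along [u] is integral; a binary form of determinant 3
   remains to be reduced. *)
pose w2 := w1 + u *~ (- B u w1).
have uw2 : B u w2 = 0 by rewrite /w2 BDr BZr u1; ring.
have disc2 : B v2 v2 * B w2 w2 - B v2 w2 ^+ 2 = 3.
  rewrite -det2 /gram u1 uv2 /w2 !(BD, BDr, BZ, BZr) (Bsym v2 u) uv2 u1 (Bsym w1 u); ring.
clearbody w2.
have [||x' [y' [z' [t' /=]]]] := @binary_reduction (B v2 v2) (B v2 w2) (B w2 w2) => //.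
  by rewrite disc2.
set A' := _ * x' ^+ 2 + _ + _; set C' := _ * z' ^+ 2 + _ + _.
set D' := _ * x' * z' + _ + _; move=> [xyzt' A'_gt0 D'1 D'2 AC'].
pose v3 := v2 *~ x' + w2 *~ y'; pose w3 := v2 *~ z' + w2 *~ t'.
have ACD' : A' * C' - D' ^+ 2 = 3.
  transitivity ((B v2 v2 * B w2 w2 - B v2 w2 ^+ 2) * (x' * t' - y' * z') ^+ 2);
    last by rewrite disc2 xyzt'.
  rewrite /A' /C' /D'; ring.
have vv3 : B v3 v3 = A'.
  by rewrite /v3 /A' !(BD, BDr, BZ, BZr) (Bsym w2 v2); ring.
have ww3 : B w3 w3 = C'.
  by rewrite /w3 /C' !(BD, BDr, BZ, BZr) (Bsym w2 v2); ring.
have vw3 : B v3 w3 = D'.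
  by rewrite /v3 /w3 /D' !(BD, BDr, BZ, BZr) (Bsym w2 v2); ring.
have uv3 : B u v3 = 0 by rewrite /v3 BDr !BZr uv2 uw2; ring.
have uw3 : B u w3 = 0 by rewrite /w3 BDr !BZr uv2 uw2; ring.
clearbody A' C' D' v3 w3.
exists u, v3, w3; split=> //; rewrite vv3 ww3 vw3 uw3.
by case: (binary_disc3 A'_gt0 ACD' D'1 D'2 AC') => [->|[-> -> ->]]; [left | right].
Qed.

End Ternary.

(** * Neighbours of the lattice x^2 + y^2 + 3z^2 *)

Notation vec := (int * int * int)%type.

Definition dot (v w : vec) : int := v.1.1 * w.1.1 + v.1.2 * w.1.2 + 3 * v.2 * w.2.
Definition cross1 (v w : vec) : int := v.1.2 * w.2 - v.2 * w.1.2.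
Definition cross2 (v w : vec) : int := v.2 * w.1.1 - v.1.1 * w.2.
Definition cross3 (v w : vec) : int := v.1.1 * w.1.2 - v.1.2 * w.1.1.
Definition scale (k : int) (v : vec) : vec := (k * v.1.1, k * v.1.2, k * v.2).
Definition lincomb (e1 e2 e3 : vec) (x : vec) : vec :=
  (x.1.1 * e1.1.1 + x.1.2 * e2.1.1 + x.2 * e3.1.1,
   x.1.1 * e1.1.2 + x.1.2 * e2.1.2 + x.2 * e3.1.2,
   x.1.1 * e1.2 + x.1.2 * e2.2 + x.2 * e3.2).
Definition det3 (u v w : vec) : int :=
  u.1.1 * cross1 v w + u.1.2 * cross2 v w + u.2 * cross3 v w.

Definition swap (v : vec) : vec := (v.1.2, v.1.1, v.2).

(** Modulo 3 the form is x^2 + y^2, which is anisotropic because -1 is not a square. *)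
Lemma dvd3_dot v w : (3 %| dot v v)%Z -> (3 %| dot v w)%Z.
Proof.
case: v w => [[x y] z] [[a b] c]; rewrite /dot /= => H.
have [Hx Hy] : (3 %| x)%Z /\ (3 %| y)%Z.
  have := divz_eq x 3; have := ltz_pmod x (isT : 0 < 3 :> int).
  have := modz_ge0 x (isT : 3 != 0 :> int).
  have := divz_eq y 3; have := ltz_pmod y (isT : 0 < 3 :> int).
  have := modz_ge0 y (isT : 3 != 0 :> int).
  move: (x %/ 3)%Z (y %/ 3)%Z (x %% 3)%Z (y %% 3)%Z => i j r s s0 s3 Ey r0 r3 Ex.
  have : (3 %| r * r + s * s)%Z.
    have -> : r * r + s * s = x * x + y * y + 3 * z * z
       - 3 * (3 * i * i + 2 * i * r + 3 * j * j + 2 * j * s + z * z).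
      by rewrite Ex Ey; ring.
    by rewrite rpredB ?dvdz_mulr.
  move=> rs.
  have /or3P r012 : [|| r == 0, r == 1 | r == 2] by lia.
  have /or3P s012 : [|| s == 0, s == 1 | s == 2] by lia.
  by case: r012 s012 rs Ex Ey => /eqP-> [] /eqP-> //= _ -> ->; rewrite !addr0 !dvdz_mull.
by rewrite !rpredD ?dvdz_mulr // ?dvdz_mulr.
Qed.

Lemma cramer (e1 e2 e3 d : vec) : det3 e1 e2 e3 != 0 ->
  dot d e1 = 0 -> dot d e2 = 0 -> dot d e3 = 0 -> d = (0, 0, 0).
Proof.
case: e1 e2 e3 d => [[a1 a2] a3] [[b1 b2] b3] [[c1 c2] c3] [[x y] z].
rewrite /det3 /cross1 /cross2 /cross3 /dot /= => D0 Ha Hb Hc.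
have cancel t : (a1 * (b2 * c3 - b3 * c2) + a2 * (b3 * c1 - b1 * c3) +
   a3 * (b1 * c2 - b2 * c1)) * t = 0 -> t = 0.
  by move/eqP; rewrite mulf_eq0 (negbTE D0) => /eqP.
have lin k l m : k * (x * a1 + y * a2 + 3 * z * a3) + l * (x * b1 + y * b2 + 3 * z * b3)
  + m * (x * c1 + y * c2 + 3 * z * c3) = 0 by rewrite Ha Hb Hc; ring.
congr (_, _, _); apply: cancel.
- rewrite -[RHS](lin (b2 * c3 - b3 * c2) (c2 * a3 - c3 * a2) (a2 * b3 - a3 * b2)); ring.
- rewrite -[RHS](lin (b3 * c1 - b1 * c3) (c3 * a1 - c1 * a3) (a3 * b1 - a1 * b3)); ring.
- have -> : forall t : int, t = 0 <-> 3 * t = 0 by move=> t; lia.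
  rewrite -[RHS](lin (b1 * c2 - b2 * c1) (c1 * a2 - c2 * a1) (a1 * b2 - a2 * b1)); ring.
Qed.

Lemma gram_det3 u v w : gram dot u v w = 3 * det3 u v w ^+ 2.
Proof. by rewrite /gram /det3 /cross1 /cross2 /cross3 /dot; ring. Qed.

Lemma dotC v w : dot v w = dot w v.
Proof. by rewrite /dot; ring. Qed.

(** * Lines modulo p and the lattices attached to them *)

Section Neighbour.
Variable p : nat.
Hypotheses (p_pr : prime p) (p_gt3 : (3 < p)%N).
Notation P := (Posz p).

Lemma primezM (x y : int) : (P %| x * y)%Z = (P %| x)%Z || (P %| y)%Z.
Proof. by rewrite !dvdzE abszM Euclid_dvdM. Qed.

Lemma primez_exp2 (x : int) : (P %| x ^+ 2)%Z = (P %| x)%Z.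
Proof. by rewrite expr2 primezM orbb. Qed.

Lemma primez2 : (P %| 2)%Z = false.
Proof. by apply/negbTE; rewrite dvdzE gtnNdvd // ltnW. Qed.

Lemma primez3 : (P %| 3)%Z = false.
Proof. by apply/negbTE; rewrite dvdzE gtnNdvd. Qed.

Lemma invz (x : int) : ~~ (P %| x)%Z -> exists y k, x * y = 1 + k * P.
Proof.
move=> ndiv; have [u [v ]] := Bezoutz x P.
have -> : gcdz x P = 1.
  apply/eqP; rewrite eqz_nat -/(coprime _ _) coprime_sym prime_coprime //.
move=> E; exists u, (- v); rewrite -E; ring.
Qed.

Definition para (v w : vec) :=
  [&& (P %| cross1 v w)%Z, (P %| cross2 v w)%Z & (P %| cross3 v w)%Z].

Definition nonzero (v : vec) := ~~ [&& (P %| v.1.1)%Z, (P %| v.1.2)%Z & (P %| v.2)%Z].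

(** Some coordinate of [u] is invertible modulo [p]; the multiplier is the quotient of the
    corresponding coordinates. *)
Lemma para_decomp v u : nonzero u -> para v u -> exists a t1 t2 t3,
  v = (a * u.1.1 + P * t1, a * u.1.2 + P * t2, a * u.2 + P * t3).
Proof.
case: v u => [[v1 v2] v3] [[u1 u2] u3]; rewrite /nonzero /para /cross1 /cross2 /cross3 /=.
move=> nz /and3P[/dvdzP[c1 E1] /dvdzP[c2 E2] /dvdzP[c3 E3]].
move: nz; rewrite !negb_and => /or3P[] /invz[y [k E]].
- exists (v1 * y), (- k * v1), (- k * v2 - c3 * y), (- k * v3 + c2 * y).
  congr (_, _, _).
  + have -> : v1 * y * u1 = v1 * (u1 * y) by ring. rewrite E; ring.
  + have -> : v1 * y * u2 + P * (- k * v2 - c3 * y) = (v1 * u2 - c3 * P) * y - k * P * v2 by ring.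
    rewrite -E3 (_ : (_ - _) * y = v2 * (u1 * y)); last by ring. rewrite E; ring.
  + have -> : v1 * y * u3 + P * (- k * v3 + c2 * y) = (v1 * u3 + c2 * P) * y - k * P * v3 by ring.
    rewrite -E2 (_ : (_ + _) * y = v3 * (u1 * y)); last by ring. rewrite E; ring.
- exists (v2 * y), (- k * v1 + c3 * y), (- k * v2), (- k * v3 - c1 * y).
  congr (_, _, _).
  + have -> : v2 * y * u1 + P * (- k * v1 + c3 * y) = (v2 * u1 + c3 * P) * y - k * P * v1 by ring.
    rewrite -E3 (_ : (_ + _) * y = v1 * (u2 * y)); last by ring. rewrite E; ring.
  + have -> : v2 * y * u2 = v2 * (u2 * y) by ring. rewrite E; ring.
  + have -> : v2 * y * u3 + P * (- k * v3 - c1 * y) = (v2 * u3 - c1 * P) * y - k * P * v3 by ring.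
    rewrite -E1 (_ : (_ - _) * y = v3 * (u2 * y)); last by ring. rewrite E; ring.
- exists (v3 * y), (- k * v1 - c2 * y), (- k * v2 + c1 * y), (- k * v3).
  congr (_, _, _).
  + have -> : v3 * y * u1 + P * (- k * v1 - c2 * y) = (v3 * u1 - c2 * P) * y - k * P * v1 by ring.
    rewrite -E2 (_ : (_ - _) * y = v1 * (u3 * y)); last by ring. rewrite E; ring.
  + have -> : v3 * y * u2 + P * (- k * v2 + c1 * y) = (v3 * u2 + c1 * P) * y - k * P * v2 by ring.
    rewrite -E1 (_ : (_ + _) * y = v2 * (u3 * y)); last by ring. rewrite E; ring.
  + have -> : v3 * y * u3 = v3 * (u3 * y) by ring. rewrite E; ring.
Qed.

(* [p] times the [p]-neighbour of Z^3 attached to the isotropic line of [u]. *)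
Definition neighbour (u w : vec) := para w u && (P ^+ 2 %| dot w u)%Z.

Lemma dvdz_sqr_mul (x : int) : (P ^+ 2 %| P * x)%Z = (P %| x)%Z.
Proof. by rewrite expr2 dvdz_mul2l //; lia. Qed.

(** Writing v = a u + P s, membership forces P to divide s.u. Hence [dot] divided by P^2 is an
    integral form on the lattice. *)
Lemma neighbour_dot u v w : nonzero u -> (P ^+ 2 %| dot u u)%Z ->
  neighbour u v -> neighbour u w -> (P ^+ 2 %| dot v w)%Z.
Proof.
move=> nz qu /andP[vu dv] /andP[wu dw].
have [a [s1 [s2 [s3 Ev]]]] := para_decomp nz vu.
have [b [t1 [t2 [t3 Ew]]]] := para_decomp nz wu.
pose s := (s1, s2, s3); pose t := (t1, t2, t3).
have su : (P %| dot s u)%Z.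
  rewrite -dvdz_sqr_mul (_ : P * _ = dot v u - a * dot u u).
    by rewrite rpredB ?dvdz_mull.
  by rewrite Ev /s /dot /=; ring.
have -> : dot v w = a * dot w u + P * (b * dot s u + P * dot s t).
  by rewrite Ev Ew /s /t /dot /=; ring.
apply: rpredD; first exact: dvdz_mull.
rewrite dvdz_sqr_mul; apply: rpredD; first exact: dvdz_mull.
exact: dvdz_mulr.
Qed.

(** For w = a u + P s with [a] prime to [p], the norm of [w] is 2 a P s.u modulo P^2, so P divides
    s.u. *)
Lemma para_neighbour u w : nonzero u -> (P ^+ 2 %| dot u u)%Z -> (P ^+ 2 %| dot w w)%Z ->
  nonzero w -> para w u -> neighbour u w.
Proof.
move=> nz qu qw nzw wu; rewrite /neighbour wu /=.
have [a [s1 [s2 [s3 Ew]]]] := para_decomp nz wu; pose s := (s1, s2, s3).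
have nda : ~~ (P %| a)%Z.
  apply/negP=> /dvdzP[k Ea]; move/negP: nzw; apply; rewrite Ew Ea /=.
  have dvd_comb x y : (P %| k * P * x + P * y)%Z.
    by rewrite (_ : _ + _ = P * (k * x + y)) ?dvdz_mulr //; ring.
  by rewrite !dvd_comb.
have : (P ^+ 2 %| P * (2 * a * dot s u))%Z.
  rewrite (_ : P * _ = dot w w - a ^+ 2 * dot u u - P ^+ 2 * dot s s).
    by apply: rpredB; [apply: rpredB => //; exact: dvdz_mull | exact: dvdz_mulr].
  by rewrite Ew /s /dot /=; ring.
rewrite dvdz_sqr_mul !primezM primez2 (negbTE nda) /= => su.
have -> : dot w u = a * dot u u + P * dot s u by rewrite Ew /s /dot /=; ring.
by apply: rpredD; [exact: dvdz_mull | rewrite dvdz_sqr_mul].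
Qed.

Lemma para_scale_neighbour u w : nonzero u -> (P ^+ 2 %| dot u u)%Z -> para w u -> 
  neighbour u (scale P w).
Proof.
move=> nz qu wu; have [a [s1 [s2 [s3 Ew]]]] := para_decomp nz wu; pose s := (s1, s2, s3).
apply/andP; split.
  by apply/and3P; rewrite /cross1 /cross2 /cross3 /= -!mulrA -!mulrBr !dvdz_mulr.
rewrite (_ : dot _ _ = P * (a * dot u u + P * dot s u)).
  rewrite dvdz_sqr_mul; apply: rpredD; last exact: dvdz_mulr.
  by apply/dvdz_mull/dvdz_trans/qu; rewrite expr2 dvdz_mulr.
by rewrite Ew /s /scale /dot /=; ring.
Qed.

(* A totally isotropic plane cannot exist in a nondegenerate ternary space. *)
Lemma isotropic_para v u : (P %| dot v v)%Z -> (P %| dot u u)%Z -> (P %| dot v u)%Z ->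
  para v u.
Proof.
case: v u => [[v1 v2] v3] [[u1 u2] u3]; set v := (v1, v2, v3); set u := (u1, u2, u3).
move=> vv uu vu.
have dvdX x y : (P %| x * dot v u - y * dot u u)%Z by rewrite rpredB // dvdz_mull.
have dvdY x y : (P %| x * dot v v - y * dot v u)%Z by rewrite rpredB // dvdz_mull.
have dvd3 x y z X X' Y : (P %| X)%Z -> (P %| X')%Z -> (P %| Y)%Z ->
  (P %| - x * X - y * X' - z * Y)%Z.
  by move=> ? ? ?; rewrite !rpredB ?dvdz_mull.
have sqr3 z : (P %| 3 * z ^+ 2)%Z -> (P %| z)%Z.
  by rewrite primezM primez3 primez_exp2.
(* The square of each cross product coordinate, times 3 for the first two, is a combination of the
   three inner products. *)
apply/and3P; split.
- apply: sqr3; have := dvd3 v2 (3 * v3) u1 _ _ _ (dvdX u2 v2) (dvdX u3 v3) (dvdY u1 v1).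
  by congr (P %| _)%Z; rewrite /cross1 /dot /=; ring.
- apply: sqr3; have := dvd3 v1 (3 * v3) u2 _ _ _ (dvdX u1 v1) (dvdX u3 v3) (dvdY u2 v2).
  by congr (P %| _)%Z; rewrite /cross2 /dot /=; ring.
- rewrite -primez_exp2.
  have := dvd3 v1 v2 (3 * u3) _ _ _ (dvdX u1 v1) (dvdX u2 v2) (dvdY u3 v3).
  by congr (P %| _)%Z; rewrite /cross3 /dot /=; ring.
Qed.

Lemma neighbour_lincomb u e1 e2 e3 x :
  neighbour u e1 -> neighbour u e2 -> neighbour u e3 -> neighbour u (lincomb e1 e2 e3 x).
Proof.
move=> /andP[/and3P[a1 a2 a3] a] /andP[/and3P[b1 b2 b3] b] /andP[/and3P[c1 c2 c3] c].
have dvd_comb (d : int) y z t : (d %| y)%Z -> (d %| z)%Z -> (d %| t)%Z ->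
  (d %| x.1.1 * y + x.1.2 * z + x.2 * t)%Z.
  by move=> ? ? ?; rewrite !rpredD ?dvdz_mull.
apply/andP; split; last first.
  have := dvd_comb _ _ _ _ a b c; congr (_ %| _)%Z; rewrite /dot /=; ring.
apply/and3P; split.
- have := dvd_comb _ _ _ _ a1 b1 c1; congr (_ %| _)%Z; rewrite /cross1 /=; ring.
- have := dvd_comb _ _ _ _ a2 b2 c2; congr (_ %| _)%Z; rewrite /cross2 /=; ring.
- have := dvd_comb _ _ _ _ a3 b3 c3; congr (_ %| _)%Z; rewrite /cross3 /=; ring.
Qed.

(* The image of the standard basis under a similitude of ratio [p] from [Z^3]
   onto [neighbour u]. *)
Definition frame (u e1 e2 e3 : vec) :=
  [/\ neighbour u e1, neighbour u e2, neighbour u e3 &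
   [/\ dot e1 e1 = P ^+ 2, dot e2 e2 = P ^+ 2, dot e3 e3 = 3 * P ^+ 2 &
   [/\ dot e1 e2 = 0, dot e1 e3 = 0 & dot e2 e3 = 0]]].

(** The orthogonal coordinates of [w] are integers by [neighbour_dot]; for [e3] the extra factor 3
    comes from [dvd3_dot]. *)
Lemma frame_surj u e1 e2 e3 w : nonzero u -> (P ^+ 2 %| dot u u)%Z -> frame u e1 e2 e3 ->
  neighbour u w -> exists x, w = lincomb e1 e2 e3 x.
Proof.
move=> nz qu [n1 n2 n3 [q1 q2 q3 [o12 o13 o23]]] nw.
have P0 : P != 0 by lia.
have /dvdzP[a Ea] := neighbour_dot nz qu nw n1.
have /dvdzP[b Eb] := neighbour_dot nz qu nw n2.
have : (3 * P ^+ 2 %| dot w e3)%Z.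
  rewrite Gauss_dvdz ?(neighbour_dot nz qu nw n3) ?andbT.
    by rewrite (_ : dot w e3 = dot e3 w); [apply: dvd3_dot; rewrite q3 dvdz_mulr | rewrite /dot; ring].
  by rewrite coprimezXr // coprimezE coprime_sym prime_coprime // gtnNdvd.
case/dvdzP=> c Ec; exists (a, b, c).
set v := lincomb _ _ _ _; pose d : vec := (w.1.1 - v.1.1, w.1.2 - v.1.2, w.2 - v.2).
have dot_v e : dot d e = dot w e - (a * dot e1 e + b * dot e2 e + c * dot e3 e).
  by rewrite /d /v /dot /=; ring.
have : d = (0, 0, 0).
  apply: (@cramer e1 e2 e3).
  - have : 3 * det3 e1 e2 e3 ^+ 2 = 3 * P ^+ 6.
      by rewrite -gram_det3 /gram q1 q2 q3 o12 o13 o23; ring.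
    move=> E; apply: contraNneq P0 => D0; move/eqP: E; rewrite D0 expr0n mulr0 eq_sym.
    by rewrite mulf_eq0 expf_eq0 /=.
  - by rewrite dot_v Ea q1 (dotC e2) (dotC e3) o12 o13; ring.
  - by rewrite dot_v Eb q2 (dotC e3) o12 o23; ring.
  - by rewrite dot_v Ec q3 o13 o23; ring.
rewrite /d; case: w v {Ea Eb Ec dot_v nw d} => [[w1 w2] w3] [[v1 v2] v3] /= [H1 H2 H3].
by congr (_, _, _); lia.
Qed.

Lemma dot_lincomb u e1 e2 e3 x : frame u e1 e2 e3 ->
  dot (lincomb e1 e2 e3 x) (lincomb e1 e2 e3 x) = P ^+ 2 * dot x x.
Proof.
move=> [_ _ _ [q1 q2 q3 [o12 o13 o23]]].
have -> : dot (lincomb e1 e2 e3 x) (lincomb e1 e2 e3 x) =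
  x.1.1 ^+ 2 * dot e1 e1 + x.1.2 ^+ 2 * dot e2 e2 + x.2 ^+ 2 * dot e3 e3
  + 2 * x.1.1 * x.1.2 * dot e1 e2 + 2 * x.1.1 * x.2 * dot e1 e3 + 2 * x.1.2 * x.2 * dot e2 e3.
  by rewrite /dot /=; ring.
by rewrite q1 q2 q3 o12 o13 o23 /dot; ring.
Qed.

Lemma lincomb_inj u e1 e2 e3 : frame u e1 e2 e3 -> injective (lincomb e1 e2 e3).
Proof.
move=> fr x y; case: fr => _ _ _ [q1 q2 q3 [o12 o13 o23]] E.
have P0 : P ^+ 2 != 0 by rewrite expf_eq0; lia.
have D v e : dot (lincomb e1 e2 e3 v) e =
  v.1.1 * dot e1 e + v.1.2 * dot e2 e + v.2 * dot e3 e by rewrite /dot /=; ring.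
have := congr1 (dot^~ e1) E; rewrite /= !D q1 (dotC e2) (dotC e3) o12 o13 !mulr0 !addr0.
move/(mulIf P0) => E1.
have := congr1 (dot^~ e2) E; rewrite /= !D q2 (dotC e3) o12 o23 !mulr0 !addr0 !add0r.
move/(mulIf P0) => E2.
have := congr1 (dot^~ e3) E; rewrite /= !D q3 o13 o23 !mulr0 !add0r.
move/(mulIf (_ : 3 * P ^+ 2 != 0)) => /(_ _)E3.
case: x y E1 E2 E3 {E} => [[? ?] ?] [[? ?] ?] /= -> -> -> //.
by rewrite mulf_eq0.
Qed.

End Neighbour.

(** * Every neighbour is isometric to Z^3 *)

Section FrameExists.
Variable p : nat.
Hypotheses (p_pr : prime p) (p_gt3 : (3 < p)%N).
Notation P := (Posz p).

Lemma vec_mulrz (v : vec) k : v *~ k = (v.1.1 * k, v.1.2 * k, v.2 * k).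
Proof.
rewrite [LHS]surjective_pairing [X in (X, _) = _]surjective_pairing.
by rewrite !(raddfMz fst) !(raddfMz snd) !mulrzz.
Qed.

Lemma dot_gt0 v : v != (0, 0, 0) -> 0 < dot v v.
Proof.
case: v => [[x y] z]; rewrite !xpair_eqE /dot /= => nz.
have := sqr_ge0 x; have := sqr_ge0 y; have := sqr_ge0 z.
rewrite !expr2 => z0 y0 x0; rewrite lt_neqAle; apply/andP; split; last by lia.
apply: contraNneq nz => E.
have [X [Y Z]] : x * x = 0 /\ y * y = 0 /\ z * z = 0 by lia.
by move/eqP: X; move/eqP: Y; move/eqP: Z; rewrite !mulf_eq0 !orbb => -> -> ->.
Qed.

(** The form [dot] / P^2 has Gram determinant 3 * P^6 / P^6 = 3 on this basis, so
    [ternary_reduction] leaves two cases. *)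
Lemma frame_of_basis u b1 b2 b3 : nonzero p u -> (P ^+ 2 %| dot u u)%Z ->
    neighbour p u b1 -> neighbour p u b2 -> neighbour p u b3 -> det3 b1 b2 b3 = P ^+ 3 ->
  exists e1 e2 e3, frame p u e1 e2 e3.
Proof.
move=> nz qu n1 n2 n3 detP.
have P_gt0 : 0 < P by lia.
have P2_gt0 : 0 < P ^+ 2 by rewrite exprn_gt0.
pose G v w := (dot v w %/ P ^+ 2)%Z.
have GE v w : neighbour p u v -> neighbour p u w -> P ^+ 2 * G v w = dot v w.
  by move=> nv nw; rewrite mulrC divzK // (neighbour_dot p_pr p_gt3 nz qu nv nw).
have dotL x y : dot (lincomb b1 b2 b3 x) (lincomb b1 b2 b3 y) = P ^+ 2 *
  (x.1.1 * y.1.1 * G b1 b1 + x.1.2 * y.1.2 * G b2 b2 + x.2 * y.2 * G b3 b3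
  + (x.1.1 * y.1.2 + x.1.2 * y.1.1) * G b1 b2 + (x.1.1 * y.2 + x.2 * y.1.1) * G b1 b3
  + (x.1.2 * y.2 + x.2 * y.1.2) * G b2 b3).
  rewrite !mulrDr !(mulrCA (P ^+ 2)) !GE // /dot /=; ring.
(* The rescaled form in coordinates with respect to [b1], [b2], [b3]. *)
pose B (x y : vec) := 
  x.1.1 * y.1.1 * G b1 b1 + x.1.2 * y.1.2 * G b2 b2 + x.2 * y.2 * G b3 b3
  + (x.1.1 * y.1.2 + x.1.2 * y.1.1) * G b1 b2 + (x.1.1 * y.2 + x.2 * y.1.1) * G b1 b3
  + (x.1.2 * y.2 + x.2 * y.1.2) * G b2 b3.
have det_neq0 : det3 b1 b2 b3 != 0 by rewrite detP expf_eq0; lia.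
have [] := @ternary_reduction _ B _ _ _ (1, 0, 0) (0, 1, 0) (0, 0, 1).
- by move=> x y; rewrite /B; ring.
- by move=> x y z; rewrite /B /=; ring.
- by move=> x k y; rewrite /B vec_mulrz /=; ring.
- rewrite /B /= !(mul1r, mul0r, mulr0, addr0) -(pmulr_rgt0 _ P2_gt0) GE // dot_gt0 //.
  by apply: contraNneq det_neq0 => ->; rewrite /det3 !mul0r.
- rewrite /B /= !(mul1r, mul0r, mulr0, addr0, mulr1, add0r).
  rewrite -(pmulr_rgt0 _ (exprn_gt0 2 P2_gt0)).
  have minor (m x y z : int) : m ^+ 2 * (x * y - z ^+ 2) = (m * x) * (m * y) - (m * z) ^+ 2.
    by ring.
  rewrite minor.
  rewrite !GE //; have [c0|c_neq0] := eqVneq (cross1 b1 b2, cross2 b1 b2, cross3 b1 b2) (0, 0, 0).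
    move: det_neq0; have -> : det3 b1 b2 b3 =
       b3.1.1 * cross1 b1 b2 + b3.1.2 * cross2 b1 b2 + b3.2 * cross3 b1 b2.
      by rewrite /det3 /cross1 /cross2 /cross3; ring.
    by case: c0 => -> -> ->; rewrite !mulr0 eqxx.
  (* Lagrange's identity for this form. *)
  have -> : dot b1 b1 * dot b2 b2 - dot b1 b2 ^+ 2 =
    3 * cross1 b1 b2 ^+ 2 + 3 * cross2 b1 b2 ^+ 2 + cross3 b1 b2 ^+ 2.
    by rewrite /dot /cross1 /cross2 /cross3; ring.
  move: c_neq0; rewrite !xpair_eqE -(sqrf_eq0 (cross1 b1 b2)).
  rewrite -(sqrf_eq0 (cross2 b1 b2)) -(sqrf_eq0 (cross3 b1 b2)).
  have := sqr_ge0 (cross1 b1 b2); have := sqr_ge0 (cross2 b1 b2); have := sqr_ge0 (cross3 b1 b2).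
  lia.
- apply: (@mulfI _ (P ^+ 6)); first by rewrite expf_eq0; lia.
  rewrite /gram /B /= !(mul1r, mul0r, mulr0, addr0, mulr1, add0r).
  transitivity (gram dot b1 b2 b3); last by rewrite gram_det3 detP; ring.
  by rewrite /gram -!GE //; ring.
move=> x [y [z [x1 xy0 y1]]].
have xN := dotL x x; rewrite -/(B x x) x1 mulr1 in xN.
have xyN := dotL x y; rewrite -/(B x y) xy0 mulr0 in xyN.
have nl v : neighbour p u (lincomb b1 b2 b3 v) by exact: neighbour_lincomb.
have yN := dotL y y; rewrite -/(B y y) in yN.
case: y1 => [y2|[y1 z3 xz0 yz0]]; last first.
  exists (lincomb b1 b2 b3 x), (lincomb b1 b2 b3 y), (lincomb b1 b2 b3 z); split=> //; split=> //.
  + by rewrite yN y1 mulr1.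
  + by rewrite dotL -/(B z z) z3 mulrC.
  split=> //; first by rewrite dotL -/(B x z) xz0 mulr0.
  by rewrite dotL -/(B y z) yz0 mulr0.
rewrite y2 in yN; move: (lincomb _ _ _ x) (lincomb _ _ _ y) xN xyN yN => X Y xN xyN yN.
(* The norm of [W] is P^2 + 2P^2, but its product with [X] is P^2, prime to 3. *)
pose W : vec := (X.1.1 + Y.1.1, X.1.2 + Y.1.2, X.2 + Y.2).
have WW : dot W W = dot X X + dot Y Y + 2 * dot X Y by rewrite /W /dot /=; ring.
have WX : dot W X = dot X X + dot X Y by rewrite /W /dot /=; ring.
(* The other class, <1> + A_2, is excluded at the prime 3. *)
have W3 : (3 %| dot W W)%Z.
  by rewrite WW xN yN xyN (_ : _ + _ = 3 * P ^+ 2) ?dvdz_mulr //; ring.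
have := dvd3_dot X W3; rewrite WX xN xyN addr0 dvdzE abszX Euclid_dvdX // andbT dvdn_prime2 //.
by move=> /eqP /= E; lia.
Qed.

Lemma para_comb a u u' (t v : vec) : ~~ (P %| a)%Z ->
  u = (a * u'.1.1 + P * t.1.1, a * u'.1.2 + P * t.1.2, a * u'.2 + P * t.2) ->
  para p v u = para p v u'.
Proof.
move=> na Eu.
have E (x y : int) : (P %| a * x + P * y)%Z = (P %| x)%Z.
  by rewrite (rpredDr _ (dvdz_mulr _ (dvdzz _))) primezM // (negbTE na).
rewrite /para -[in RHS](E _ (cross1 v t)) -[in RHS](E _ (cross2 v t)) -[in RHS](E _ (cross3 v t)).
by congr [&& _, _ & _]; congr (P %| _)%Z; rewrite Eu /cross1 /cross2 /cross3 /=; ring.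
Qed.

Lemma dvd_3_sqr (u3 : int) : (P %| 3 * u3 * u3)%Z -> (P %| u3)%Z.
Proof. by rewrite !primezM // primez3 //= orbb. Qed.

(** A basis is [u] with P(0, s, t), where (s, t) runs over a basis of the index-P lattice b s + 3 c
    t = 0 modulo P. *)
Lemma frame_normal b c (u : vec := (1, b, c)) : (P ^+ 2 %| dot u u)%Z ->
  exists e1 e2 e3, frame p u e1 e2 e3.
Proof.
move=> qu; have nz : nonzero p u.
  by rewrite /nonzero /= dvdzE /= dvdn1; case: eqP p_gt3 => // ->.
have [s1 [t1 [s2 [t2 [H1 H2 D]]]]] : exists s1 t1 s2 t2 : int,
  [/\ (P %| b * s1 + 3 * c * t1)%Z, (P %| b * s2 + 3 * c * t2)%Z & s1 * t2 - t1 * s2 = P].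
  have [Pb|nPb] := boolP (P %| b)%Z.
    exists 1, 0, 0, P; split; last by ring.
      by rewrite mulr1 mulr0 addr0.
    by rewrite mulr0 add0r dvdz_mull.
  have [y [k E]] := invz p_pr nPb.
  exists P, 0, (- 3 * c * y), 1; split; last by ring.
    by rewrite mulr0 addr0 dvdz_mull.
  rewrite (_ : _ + _ = 3 * c * (1 - b * y)); last by ring.
  by rewrite E (_ : _ * _ = - 3 * c * k * P) ?dvdz_mull //; ring.
have N s t : (P %| b * s + 3 * c * t)%Z -> neighbour p u (0, P * s, P * t).
  move=> H; apply/andP; split; last first.
    rewrite (_ : dot _ u = P * (b * s + 3 * c * t)) ?dvdz_sqr_mul //.
    by rewrite /dot /=; ring.
  rewrite /para /cross1 /cross2 /cross3 /= !mul0r subr0 sub0r !mulr1 rpredN !dvdz_mulr // !andbT.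
  by rewrite -!mulrA -mulrBr dvdz_mulr.
apply: (frame_of_basis (b1 := u) (b2 := (0, P * s1, P * t1)) (b3 := (0, P * s2, P * t2))) => //.
- by rewrite /neighbour qu andbT /para /cross1 /cross2 /cross3 /= !mulr1 !mul1r mulrC !subrr !dvdz0.
- exact: N.
- exact: N.
- by rewrite /det3 /cross1 /cross2 /cross3 /= -D; ring.
Qed.

(** Hensel lifting: the line is normalised to (1, b0, c0) and its isotropy is lifted from P to
    P^2. *)
Lemma frame_exists_aux u : (P %| dot u u)%Z -> ~~ (P %| u.1.1)%Z ->
  exists u' e1 e2 e3, [/\ nonzero p u', (P ^+ 2 %| dot u' u')%Z,
    forall v, para p v u = para p v u' & frame p u' e1 e2 e3].
Proof.
case: u => [[u1 u2] u3] /= qu nP; have [y [k E]] := invz p_pr nP.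
pose b0 := u2 * y; pose c0 := u3 * y.
have [m Em] : exists m, 1 + b0 ^+ 2 + 3 * c0 ^+ 2 = P * m.
  have /dvdzP[d Ed] := qu; exists (y ^+ 2 * d - 2 * k - k ^+ 2 * P).
  transitivity (y ^+ 2 * (d * P) + 1 - (u1 * y) ^+ 2); last by rewrite E; ring.
  by rewrite -Ed /dot /b0 /c0 /=; ring.
have not1 : ~~ (P %| 1%R)%Z by rewrite dvdzE /= dvdn1; lia.
(* Solvable because [b0] and [c0] cannot both vanish modulo P: otherwise P would divide 1. *)
have [s [t Hst]] : exists s t : int, (P %| m + 2 * b0 * s + 6 * c0 * t)%Z.
  have [Pb|nPb] := boolP (P %| 2 * b0)%Z; last first.
    have [z [l El]] := invz p_pr nPb; exists (- m * z), 0.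
    have -> : m + 2 * b0 * (- m * z) + 6 * c0 * 0 = m * (1 - 2 * b0 * z) by ring.
    by rewrite El opprD addrA subrr sub0r -mulNr mulrA dvdz_mull.
  have nPc : ~~ (P %| 6 * c0)%Z.
    apply: contra not1 => Pc.
    have Pb0 : (P %| b0)%Z by move: Pb; rewrite primezM // primez2.
    have Pc0 : (P %| c0)%Z.
      move: Pc; have -> : 6 * c0 = 2 * (3 * c0) by ring.
      by rewrite !primezM // primez2 // primez3.
    rewrite (_ : 1 = P * m - b0 * b0 - 3 * c0 * c0); last by rewrite -Em; ring.
    by apply: rpredB; [apply: rpredB; [exact: dvdz_mulr|]|]; exact: dvdz_mull.
  have [z [l El]] := invz p_pr nPc; exists 0, (- m * z).
  have -> : m + 2 * b0 * 0 + 6 * c0 * (- m * z) = m * (1 - 6 * c0 * z) by ring.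
  by rewrite El opprD addrA subrr sub0r -mulNr mulrA dvdz_mull.
pose b := b0 + P * s; pose c := c0 + P * t.
have qu' : (P ^+ 2 %| dot (1, b, c) (1, b, c))%Z.
  have -> : dot (1, b, c) (1, b, c) = (1 + b0 ^+ 2 + 3 * c0 ^+ 2)
     + P * (2 * b0 * s + 6 * c0 * t) + P ^+ 2 * (s ^+ 2 + 3 * t ^+ 2).
    by rewrite /dot /b /c /=; ring.
  rewrite Em -mulrDr; apply: rpredD; last exact: dvdz_mulr.
  by rewrite dvdz_sqr_mul // addrA.
have [e1 [e2 [e3 fr]]] := frame_normal qu'.
exists (1, b, c), e1, e2, e3; split=> //.
  by rewrite /nonzero /= (negbTE not1).
move=> v; apply: (@para_comb u1 _ _ (0, - u2 * k - u1 * s, - u3 * k - u1 * t)) => //=.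
congr (_, _, _); first by ring.
  rewrite /b /b0 (_ : _ + _ = u2 * (u1 * y) - P * u2 * k); last by ring.
  by rewrite E; ring.
rewrite /c /c0 (_ : _ + _ = u3 * (u1 * y) - P * u3 * k); last by ring.
by rewrite E; ring.
Qed.

Lemma dot_swap v w : dot (swap v) (swap w) = dot v w.
Proof. by rewrite /dot /=; ring. Qed.

Lemma para_swap v w : para p (swap v) (swap w) = para p v w.
Proof.
rewrite /para andbCA; congr [&& _, _ & _].
- by rewrite -[RHS]rpredN; congr (_ %| _)%Z; rewrite /cross1 /cross2 /=; ring.
- by rewrite -[RHS]rpredN; congr (_ %| _)%Z; rewrite /cross1 /cross2 /=; ring.
- by rewrite -[RHS]rpredN; congr (_ %| _)%Z; rewrite /cross3 /=; ring.
Qed.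

Lemma neighbour_swap u w : neighbour p (swap u) (swap w) = neighbour p u w.
Proof. by rewrite /neighbour para_swap dot_swap. Qed.

Lemma swapK : involutive swap.
Proof. by case=> [[]]. Qed.

(** A nonzero isotropic vector has one of its first two coordinates invertible, since otherwise 3
    z^2 = 0; [swap] brings it to the front. *)
Lemma frame_exists u : nonzero p u -> (P %| dot u u)%Z ->
  exists u' e1 e2 e3, [/\ nonzero p u', (P ^+ 2 %| dot u' u')%Z,
    forall v, para p v u = para p v u' & frame p u' e1 e2 e3].
Proof.
move=> nz qu; have [P1|] := boolP (P %| u.1.1)%Z; last exact: frame_exists_aux.
have [P2|nP2] := boolP (P %| u.1.2)%Z.
  case/negP: nz; rewrite P1 P2 /=; apply: dvd_3_sqr.
  rewrite (_ : _ * _ = dot u u - u.1.1 * u.1.1 - u.1.2 * u.1.2); last by rewrite /dot; ring.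
  by apply: rpredB; [apply: rpredB => //|]; exact: dvdz_mull.
have [||u' [e1 [e2 [e3 [nz' qu' par fr]]]]] := @frame_exists_aux (swap u) => //.
  by rewrite dot_swap.
exists (swap u'), (swap e1), (swap e2), (swap e3); split.
- by move: nz'; rewrite /nonzero /= andbCA.
- by rewrite dot_swap.
- by move=> v; rewrite -para_swap par -para_swap swapK.
case: fr => n1 n2 n3 [q1 q2 q3 [o12 o13 o23]].
by split; rewrite ?neighbour_swap //; split; rewrite ?dot_swap //; split; rewrite ?dot_swap.
Qed.

End FrameExists.

(** * Counting representations *)

(** All orbits of [f] in [U] have three elements. *)
Lemma dvd3_card_order3 (T : finType) (f : T -> T) (U : {set T}) :
    (forall x, f (f (f x)) = x) -> (forall x, x \in U -> f x \in U) ->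
    (forall x, x \in U -> f x != x) -> (3 %| #|U|)%N.
Proof.
move=> f3 fU fne; have f_inj : injective f by move=> x y /(congr1 (f \o f)) /=; rewrite !f3.
have fcl : fclosed f U.
  move=> x _ /eqP <-; apply/idP/idP => [/fU //|/fU/fU]; by rewrite f3.
rewrite -(fcard_order_set f_inj (n := 3) _ fcl) ?dvdn_mull //.
apply/subsetP=> x xU; rewrite inE; apply/eqP.
apply: (@order_cycle _ f [:: x; f x; f (f x)]); rewrite ?inE ?eqxx //=.
  by rewrite f3 !eqxx.
have ne := fne x xU.
have ne2 : f (f x) != x by apply: contra ne => /eqP E; have := f3 x; rewrite E => ->.
by rewrite !inE !negb_or andbT eq_sym ne eq_sym ne2 (inj_eq f_inj) eq_sym ne.
Qed.

Section Count.
Variable K : nat.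
Notation I := 'I_K.*2.+1.
Notation T := (I * I * I)%type.

Definition emb (t : T) : vec := (t.1.1%:Z - K%:Z, t.1.2%:Z - K%:Z, t.2%:Z - K%:Z).
Definition inbox (v : vec) := [&& `|v.1.1| <= K%:Z, `|v.1.2| <= K%:Z & `|v.2| <= K%:Z].
Definition unemb (v : vec) : T :=
  (inord `|v.1.1 + K%:Z|, inord `|v.1.2 + K%:Z|, inord `|v.2 + K%:Z|).

Lemma unembK v : inbox v -> emb (unemb v) = v.
Proof.
case: v => [[x y] z]; rewrite /inbox /emb /unemb /= => /and3P[hx hy hz].
by congr (_, _, _); rewrite inordK; lia.
Qed.

Lemma emb_inj : injective emb.
Proof.
move=> [[i j] l] [[i' j'] l'] [E1 E2 E3]; congr (_, _, _); apply/val_inj => /=; lia.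
Qed.

Lemma dot_inbox v : dot v v <= K%:Z -> inbox v.
Proof.
case: v => [[x y] z]; rewrite /dot /inbox /= => H.
have h (t : int) : 0 <= t * t by rewrite -expr2 sqr_ge0.
have g (t : int) : `|t| <= t * t by nia.
have := h x; have := h y; have := h z; have := g x; have := g y; have := g z.
by move=> *; apply/and3P; split; lia.
Qed.

(** By [dot_inbox], the box contains all vectors of norm [N] once [N <= K]. *)
Definition reps (N : int) : {set T} := [set t | dot (emb t) (emb t) == N].

Lemma theta_coef (F : fieldType) (n : nat) :
  (theta F K ^+ 2 * (theta F K \Po 'X^3))`_n = (-1) ^+ n * #|reps n|%:R.
Proof.
pose g (i : I) := `|i%:Z - K%:Z|%N.
have thetaE : theta F K = \sum_i (-1) ^+ g i *: 'X^(g i ^ 2).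
  apply: eq_bigr => i _; rewrite -mul_polyC rmorphXn rmorphN1.
  by rewrite /g.
have theta3E : theta F K \Po 'X^3 = \sum_i (-1) ^+ g i *: 'X^(3 * g i ^ 2).
  rewrite thetaE raddf_sum; apply: eq_bigr => i _ /=.
  by rewrite comp_polyZ comp_Xn_poly -exprM.
rewrite theta3E expr2 thetaE big_distrlr /= pair_big /= big_distrlr /= pair_big /= coef_sum.
transitivity (\sum_(t : T) (if t \in reps n then (-1) ^+ n else 0 : F)); last first.
  by rewrite -big_mkcond sumr_const mulr_natr.
apply: eq_bigr => -[[i j] l] _; rewrite inE /dot /emb /=.
rewrite -!scalerAl -!scalerAr -!scalerAl !scalerA -!exprD coefZ coefXn.
have -> : ((i%:Z - K%:Z) * (i%:Z - K%:Z) + (j%:Z - K%:Z) * (j%:Z - K%:Z)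
  + 3 * (l%:Z - K%:Z) * (l%:Z - K%:Z) == n)
  = (n == g i ^ 2 + g j ^ 2 + 3 * g l ^ 2)%N.
  have sqrE (x : int) : x * x = (`|x| ^ 2)%N by rewrite PoszM -!expr2; lia.
  by rewrite -mulrA !sqrE -/(g i) -/(g j) -/(g l) eq_sym.
case: eqP => [->|_]; last by rewrite mulr0.
(* The sign depends only on the norm: x + y + z and x^2 + y^2 + 3z^2 have the same parity. *)
rewrite mulr1 -[LHS]signr_odd -[RHS]signr_odd !oddD oddM !oddX /=.
by case: (odd (g i)); case: (odd (g j)); case: (odd (g l)).
Qed.

End Count.

Lemma dot_ge0 v : 0 <= dot v v.
Proof.
rewrite /dot; have h (x : int) : 0 <= x * x by rewrite -expr2 sqr_ge0.
by have := h v.1.1; have := h v.1.2; have := h v.2; lia.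
Qed.

(** * Isotropic lines modulo p and the double count *)

Section Isotropic.
Variable p : nat.
Hypotheses (p_pr : prime p) (p_gt3 : (3 < p)%N).
Notation P := (Posz p).
Notation F := 'F_p.
Notation V3 := (F * F * F)%type.

Definition lift (u : V3) : vec := ((val u.1.1)%:Z, (val u.1.2)%:Z, (val u.2)%:Z).
Definition red (v : vec) : V3 := (v.1.1%:~R, v.1.2%:~R, v.2%:~R).

Lemma liftK u : red (lift u) = u.
Proof. by case: u => [[x y] z]; rewrite /red /lift /= -!pmulrn !natr_Zp. Qed.

Lemma dvdp_red (x : int) : (P %| x)%Z = (x%:~R == 0 :> F).
Proof. exact/dvdz_pcharf/pchar_Fp. Qed.

Lemma nonzero_red v : nonzero p v = (red v != (0, 0, 0)).
Proof. by rewrite /nonzero !dvdp_red !xpair_eqE andbA. Qed.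

Lemma dot_red v : (P %| dot v v)%Z =
  ((red v).1.1 ^+ 2 + (red v).1.2 ^+ 2 + 3 * (red v).2 ^+ 2 == 0).
Proof.
rewrite dvdp_red /dot !rmorphD !rmorphM /= !expr2.
by congr (_ == _); ring.
Qed.

Definition isotropic : {set V3} :=
  [set u | nonzero p (lift u) && (P %| dot (lift u) (lift u))%Z].

Lemma mem_isotropic u : (u \in isotropic) =
  (u != (0, 0, 0)) && (u.1.1 ^+ 2 + u.1.2 ^+ 2 + 3 * u.2 ^+ 2 == 0).
Proof. by rewrite inE nonzero_red dot_red liftK. Qed.

Lemma F2_neq0 : 2 != 0 :> F.
Proof. by have := primez2 p_gt3; rewrite dvdp_red => ->. Qed.

Lemma F3_neq0 : 3 != 0 :> F.
Proof. by have := primez3 p_gt3; rewrite dvdp_red => ->. Qed.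

(* Multiplication by (-1 + sqrt (-3)) / 2 on the norm form x^2 + 3 z^2. *)
Definition omega (u : V3) : V3 := ((- u.1.1 - 3 * u.2) / 2, u.1.2, (u.1.1 - u.2) / 2).

(** A fixed point of [omega] has x = z = 0, and isotropy then forces y = 0. *)
Lemma dvd3_isotropic : (3 %| #|isotropic|)%N.
Proof.
have n2 := F2_neq0; have n3 := F3_neq0.
apply: (@dvd3_card_order3 _ omega) => u.
- by case: u => [[x y] z]; rewrite /omega /=; congr (_, _, _); field.
- rewrite !mem_isotropic => /andP[nz /eqP q0]; apply/andP; split; last first.
    by apply/eqP; rewrite -q0 /omega /=; field.
  apply: contra nz; rewrite /omega !xpair_eqE => /andP[/andP[/eqP E1 /eqP E2] /eqP E3].
  have xz : u.1.1 = u.2.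
    apply/eqP; rewrite -subr_eq0; move/eqP: E3.
    by rewrite mulf_eq0 invr_eq0 (negbTE n2) orbF.
  have z0 : u.2 = 0.
    move/eqP: E1; rewrite xz mulf_eq0 invr_eq0 (negbTE n2) orbF.
    rewrite (_ : _ - _ = - (2 * 2 * u.2)); last by ring.
    by rewrite oppr_eq0 !mulf_eq0 (negbTE n2) /= => /eqP.
  by case: u E2 xz z0 {E1 E3 q0} => [[x y] z] /= -> -> ->.
rewrite mem_isotropic => /andP[nz /eqP q0]; apply: contra nz.
case: u q0 => [[x y] z] /= q0; rewrite /omega !xpair_eqE /= => /andP[/andP[/eqP E1 _] /eqP E3].
have x3 : x = 3 * z.
  have : (x - z) / 2 * 2 = z * 2 by rewrite E3.
  rewrite divfK // => H; rewrite -[x](subrK z) H; ring.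
have z0 : z = 0.
  have : (- x - 3 * z) / 2 * 2 = x * 2 by rewrite E1.
  rewrite divfK // x3 => H; have : 2 * 2 * 3 * z = 0.
    transitivity (3 * z * 2 - (- (3 * z) - 3 * z)); first by ring.
    by rewrite H; ring.
  by move/eqP; rewrite !mulf_eq0 (negbTE n2) (negbTE n3) /= => /eqP.
move: q0; rewrite x3 z0 !mulr0 expr0n /= add0r mulr0 addr0 => /eqP.
by rewrite sqrf_eq0 => /eqP->.
Qed.

Lemma paraC v w : para p v w = para p w v.
Proof.
rewrite /para; congr [&& _, _ & _]; rewrite -[RHS]rpredN; congr (_ %| _)%Z.
- by rewrite /cross1; ring.
- by rewrite /cross2; ring.
- by rewrite /cross3; ring.
Qed.

(** These are the p - 1 nonzero multiples of the reduction of [v]. *)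
Lemma card_isotropic_line v : nonzero p v -> (P %| dot v v)%Z ->
  #|[set u in isotropic | para p v (lift u)]| = p.-1.
Proof.
move=> nz qv; pose f (c : F) : V3 := (c * (red v).1.1, c * (red v).1.2, c * (red v).2).
have -> : [set u in isotropic | para p v (lift u)] = f @: [set~ 0].
  apply/setP=> u; rewrite [LHS]inE andbC; apply/idP/imsetP => [|[c]].
    case/andP; rewrite paraC => /(para_decomp p_pr nz) [a [t1 [t2 [t3 E]]]].
    rewrite mem_isotropic => /andP[unz _].
    have P0 : P%:~R = 0 :> F by apply/eqP; rewrite -dvdp_red.
    have Eu : u = f a%:~R.
      by rewrite -[LHS]liftK E /red /f /= !rmorphD !rmorphM /= P0 !mul0r !addr0.
    exists a%:~R => //; rewrite !inE; apply: contra unz => /eqP a0.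
    by rewrite Eu /f a0 !mul0r.
  rewrite !inE => c0 ->; apply/andP; split.
    have fE : red (lift (f c)) = f c by rewrite liftK.
    rewrite /para !dvdp_red /cross1 /cross2 /cross3 !rmorphB !rmorphM /=.
    have /= -> := congr1 (fun u : V3 => u.1.1) fE.
    have /= -> := congr1 (fun u : V3 => u.1.2) fE.
    have /= -> := congr1 (fun u : V3 => u.2) fE.
    by rewrite /f /=; apply/and3P; split; apply/eqP; ring.
  have := mem_isotropic (f c); rewrite inE => ->.
  move: nz qv; rewrite nonzero_red dot_red /f; case: (red v) => [[x y] z] /=.
  rewrite !xpair_eqE !mulf_eq0 (negbTE c0) /= => -> /eqP q0 /=.
  apply/eqP; transitivity (c ^+ 2 * (x ^+ 2 + y ^+ 2 + 3 * z ^+ 2)); first by ring.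
  by rewrite q0 mulr0.
rewrite card_imset ?cardsC1 ?card_Fp // => c d E.
have := congr1 (fun u : V3 => u.1.1) E; have := congr1 (fun u : V3 => u.1.2) E.
have := congr1 (fun u : V3 => u.2) E.
move: nz; rewrite nonzero_red /f {E}; case: (red v) => [[x y] z] /= + E3 E2 E1.
rewrite !xpair_eqE !negb_and -orbA => /or3P[] h; exact: (mulIf h).
Qed.

(** Gives a vector of norm P^3 m a line modulo [p]: one division by P is enough, because w / P has
    norm P m, not divisible by P^2. *)
Definition prim (w : vec) : vec :=
  if nonzero p w then w else ((w.1.1 %/ P)%Z, (w.1.2 %/ P)%Z, (w.2 %/ P)%Z).

Lemma primP m w : ~~ (P %| m)%Z -> dot w w = P ^+ 2 * (P * m) ->
  [/\ nonzero p (prim w), (P %| dot (prim w) (prim w))%Z &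
    if nonzero p w then prim w = w else
      w = scale P (prim w) /\ dot (prim w) (prim w) = P * m].
Proof.
move=> nm qw; rewrite /prim; case: ifP => [nz|/negbFE /and3P[d1 d2 d3]].
  by split=> //; rewrite qw expr2 -!mulrA dvdz_mulr.
set v := (_, _, _); have P0 : P ^+ 2 != 0 by rewrite expf_eq0; lia.
have wE : w = scale P v.
  by rewrite /scale /v /= ![P * _]mulrC !divzK //; case: w {qw d1 d2 d3 v} => [[]].
have qv : dot v v = P * m.
  by apply: (mulfI P0); rewrite -qw [in RHS]wE /scale /dot /=; ring.
split=> //; last by rewrite qv dvdz_mulr.
apply: contra nm => /and3P[/dvdzP[a Ea] /dvdzP[b Eb] /dvdzP[c Ec]].
apply/dvdzP; exists (a ^+ 2 + b ^+ 2 + 3 * c ^+ 2).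
have P1 : P != 0 by lia.
by apply: (mulfI P1); rewrite -qv /dot Ea Eb Ec; ring.
Qed.

Section Fibres.
Variables (K : nat) (m : int).
Hypotheses (ndm : ~~ (P %| m)%Z) (K_big : P ^+ 2 * (P * m) <= K%:Z).

Definition incident (t : 'I_K.*2.+1 * 'I_K.*2.+1 * 'I_K.*2.+1) (u : V3) :=
  para p (prim (emb t)) (lift u).

(** Incidence with [u] is membership in the neighbour of a lift [u'] of the same line, and the frame
    carries vectors of norm P m bijectively onto its vectors of norm P^3 m. *)
Lemma card_fibre u : u \in isotropic ->
  #|[set t in reps K (P ^+ 2 * (P * m)) | incident t u]| = #|reps K (P * m)|.
Proof.
rewrite inE => /andP[nz qu].
have [u' [e1 [e2 [e3 [nz' qu' par fr]]]]] := frame_exists p_pr p_gt3 nz qu.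
have P2 : P ^+ 2 != 0 by rewrite expf_eq0; lia.
have dvdPP (x : int) : (P ^+ 2 %| x)%Z -> (P %| x)%Z.
  by apply: dvdz_trans; rewrite expr2 dvdz_mulr.
pose b := lincomb e1 e2 e3.
have embR : forall t, t \in reps K (P * m) -> inbox K (b (emb t)) /\ 
    dot (b (emb t)) (b (emb t)) = P ^+ 2 * (P * m).
  move=> t; rewrite inE => /eqP qt.
  have E : dot (b (emb t)) (b (emb t)) = P ^+ 2 * (P * m) by rewrite (dot_lincomb _ fr) qt.
  by split=> //; apply: dot_inbox; rewrite E.
rewrite -(card_in_imset (f := fun t => unemb K (b (emb t))) (D := reps K (P * m))); last first.
  move=> t t' /embR[bt _] /embR[bt' _] /(congr1 (@emb K)); rewrite !unembK //.
  by move/(lincomb_inj p_pr p_gt3 fr)/emb_inj.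
apply: eq_card => t; rewrite inE inE; apply/andP/imsetP => [[qt inc]|[x xR ->]].
  have {}qt := eqP qt.
  have [nzp qp E] := primP ndm qt.
  have nw : neighbour p u' (emb t).
    move: inc; rewrite /incident par => inc; move: E; case: ifP => [nzw E|_ [-> _]].
      by apply: para_neighbour => //; [rewrite qt dvdz_mulr | rewrite -E].
    exact: para_scale_neighbour.
  have [x Ex] := frame_surj p_pr p_gt3 nz' qu' fr nw.
  have qx : dot x x = P * m.
    by apply: (mulfI P2); rewrite -(dot_lincomb _ fr) -Ex.
  have bx : inbox K x.
    apply: dot_inbox; rewrite qx; apply: le_trans K_big.
    rewrite ler_peMl ?exprn_ege1 //; last by lia.
    by rewrite -qx dot_ge0.
  exists (unemb K x); first by rewrite inE unembK // qx.
  by apply: emb_inj; rewrite (unembK bx) /b -Ex unembK //; apply: dot_inbox; rewrite qt.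
have [bx qbx] := embR x xR; rewrite /incident unembK //; split; first by rewrite qbx.
have [nzp qp E] := primP ndm qbx; rewrite par.
have /andP[pbx dbx] : neighbour p u' (b (emb x)).
  by case: fr => n1 n2 n3 _; exact: neighbour_lincomb.
move: E; case: ifP => [_ ->|_ [Eb _]] //.
(* When w = P v, the divisibility of w.u' by P^2 makes [v] orthogonal to [u'] modulo P. *)
apply: isotropic_para => //; first exact: dvdPP.
rewrite -dvdz_sqr_mul // (_ : P * _ = dot (b (emb x)) u') // [in RHS]Eb.
by rewrite /dot /scale /=; ring.
Qed.

Lemma dvd3_reps : (p %% 3 = 2)%N -> (3 %| #|reps K (P ^+ 2 * (P * m))|)%N.
Proof.
move=> p_mod3; set W := reps _ _.
(* Incident pairs are counted first by vector, then by isotropic vector modulo [p]. *)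
have : (#|W| * p.-1 = #|isotropic| * #|reps K (P * m)|)%N.
  rewrite -!sum_nat_const.
  transitivity (\sum_(t in W) \sum_(u in isotropic) incident t u)%N.
    apply: eq_bigr => t; rewrite inE => /eqP qt.
    have [nzp qp _] := primP ndm qt.
    rewrite -(card_isotropic_line nzp qp) -sum1_card big_mkcond [RHS]big_mkcond /=.
    by apply: eq_bigr => u _; rewrite !inE /incident; do !case: ifP => //; case: para.
  rewrite exchange_big /=; apply: eq_bigr => u uI.
  rewrite -(card_fibre uI) -sum1_card big_mkcond [RHS]big_mkcond /=.
  by apply: eq_bigr => t _; rewrite !inE; do !case: ifP => //; case: incident.
move=> E; have : (3 %| #|W| * p.-1)%N by rewrite E dvdn_mulr // dvd3_isotropic.
by rewrite Euclid_dvdM // => /orP[] //; lia.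
Qed.

End Fibres.
End Isotropic.

(** * Conclusion for overpartition numbers *)

Lemma theta5_coef_eq0 (Q n L : nat) (t := theta 'F_3 (3 * L)) :
    prime Q -> Q = 5 %[mod 6] -> coprime n Q -> (Q ^ 3 * n <= L)%N ->
  (t ^+ 5)`_(Q ^ 3 * n) = 0.
Proof.
move=> Q_pr Q_mod6 co_nQ le_L.
have Q_gt3 : (3 < Q)%N by lia.
have -> : t ^+ 5 = t ^+ 2 * (t \Po 'X^3) by rewrite -F3_cube -exprD.
have NE : (Q ^ 3 * n)%:Z = Q%:Z ^+ 2 * (Q%:Z * n%:Z) by lia.
rewrite theta_coef NE -Fp_nat_mod // (eqP (dvd3_reps _ _ _ _ _)) ?mulr0 //.
- by rewrite dvdzE /= -prime_coprime // coprime_sym.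
- by rewrite -NE; lia.
- by lia.
Qed.

Local Close Scope ring_scope.

Theorem theorem1p2 (Q : nat) (primeQ : prime Q) (Q_mod6 : Q = 5 %[mod 6]) :
  (forall n : nat, 0 < n -> coprime n Q ->
     pbar (3 * Q ^ 3 * n) = 0 %[mod 3]) /\
  (forall n : nat, 0 < n -> coprime n Q -> n.+1 = 0 %[mod 3] ->
     pbar (Q ^ 3 * n) = 0 %[mod 3]).
Proof.
have pbar0 m : ((pbar m)%:R = 0 :> 'F_3)%R -> pbar m = 0 %[mod 3].
  by move/(congr1 val); rewrite /= val_Fp_nat // mod0n.
split=> n _ co_nQ => [|n_mod3]; apply: pbar0.
  rewrite -mulnA; have [-> _] := pbar_theta5 (leqnn (9 * (Q ^ 3 * n) + 9)).
  by apply: theta5_coef_eq0 => //; lia.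
(* Both Q^3 and [n] are -1 modulo 3. *)
have Q3n_mod3 : (Q ^ 3 * n) %% 3 = 1.
  have Q_mod3 : Q %% 3 = 2 by lia.
  have n_mod : n %% 3 = 2 by lia.
  by rewrite -modnMm -modnXm Q_mod3 n_mod.
have [k Q3nE] : exists k, Q ^ 3 * n = 3 * k + 1.
  by exists (Q ^ 3 * n %/ 3); rewrite {1}(divn_eq (Q ^ 3 * n) 3) Q3n_mod3 mulnC.
rewrite Q3nE; have [_ ->] := pbar_theta5 (leqnn (9 * k + 9)).
(* The index 3 Q^3 n is read as Q^3 (3n), with 3n still coprime to [Q]. *)
rewrite -Q3nE mulnCA theta5_coef_eq0 ?mul0rn //.
  by rewrite coprimeMl co_nQ andbT prime_coprime //; lia.
by rewrite mulnCA Q3nE; lia.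
Qed.
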